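(* Let $\mathbb{M}=(M_p)_{p\in\mathbb{N}_0}$ be a weight sequence. Then $$S_{\mathbb{M}}\cap I_{\mathbb{M}}=\widetilde{S}^u_{\mathbb{M}}\cap\widetilde{I}^u_{\mathbb{M}}=\widetilde{S}_{\mathbb{M}}\cap\widetilde{I}_{\mathbb{M}}=\emptyset.$$ In other words, for every $\gamma>0$, the Borel map into $\mathbb{C}[[z]]_{\mathbb{M}}$ is not bijective on any of the three classes $\mathcal{A}_{\mathbb{M}}(S_\gamma)$, $\widetilde{\mathcal{A}}^u_{\mathbb{M}}(S_\gamma)$, $\widetilde{\mathcal{A}}_{\mathbb{M}}(S_\gamma)$.
   Context: Sequences. $\mathbb{N}_0=\{0,1,2,\dots\}$. A weight sequence is a sequence $\mathbb{M}=(M_p)_{p\in\mathbb{N}_0}$ of positive reals with $M_0=1$, logarithmically convex ($M_p^2\le M_{p-1}M_{p+1}$ for $p\ge1$), whose sequence of quotients $m_p:=M_{p+1}/M_p$ tends to $\infty$. Sectors. $\mathcal{R}$ is the Riemann surface of the logarithm. For $\gamma>0$, $S_\gamma=\{z\in\mathcal{R}:|\arg z|<\gamma\pi/2\}$ (unbounded). A bounded sector $T=\{z\in\mathcal{R}:|\arg z-d|<\alpha\pi/2,\ |z|<r\}$ is a proper subsector of $S_\gamma$, written $T\ll S_\gamma$, if its closure in $\mathcal{R}$ (so the vertex $0$ is not considered) is contained in $S_\gamma$. Classes, for $S=S_\gamma$. $\widetilde{\mathcal{A}}_{\mathbb{M}}(S)$: holomorphic $f:S\to\mathbb{C}$ for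 which there is a formal series $\widehat f=\sum_{p\ge0}a_pz^p$ such that for every $T\ll S$ there are $C_T,A_T>0$ with $|f(z)-\sum_{n=0}^{p-1}a_nz^n|\le C_TA_T^pM_p|z|^p$ for all $z\in T$, $p\in\mathbb{N}_0$. $\widetilde{\mathcal{A}}^u_{\mathbb{M}}(S)$: same, but with constants $C,A>0$ valid for all $z\in S$, $p\in\mathbb{N}_0$. $\mathcal{A}_{\mathbb{M}}(S)$: holomorphic $f$ on $S$ for which there is $A>0$ with $\sup_{z\in S,\,n\in\mathbb{N}_0}\frac{|f^{(n)}(z)|}{A^nn!M_n}<\infty$. One has $\mathcal{A}_{\mathbb{M}}(S)\subseteq\widetilde{\mathcal{A}}^u_{\mathbb{M}}(S)\subseteq\widetilde{\mathcal{A}}_{\mathbb{M}}(S)$, $\widehat f$ is unique, and $a_p=\lim_{z\to0,z\in T}f^{(p)}(z)/p!$ for any $T\ll S$. $\mathbb{C}[[z]]_{\mathbb{M}}$ is the set of $\sum a_pz^p\in\mathbb{C}[[z]]$ for which there is $A>0$ with $\sup_p|a_p|/(A^pM_p)<\infty$. The asymptotic Borel map $\widetilde{\mathcal{B}}$ sends $f$ to $\widehat f\in\mathbb{C}[[z]]_{\mathbb{M}}$. Intervals. $I_{\mathbb{M}}$, $\widetilde{I}^u_{\mathbb{M}}$, $\widetilde{I}_{\mathbb{M}}$ (resp. $S_{\mathbb{M}}$, $\widetilde{S}^u_{\mathbb{M}}$, $\widetilde{S}_{\mathbb{M}}$) are the sets of $\gamma>0$ such that $\widetilde{\mathcal{B}}$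 is injective (resp. surjective onto $\mathbb{C}[[z]]_{\mathbb{M}}$) on $\mathcal{A}_{\mathbb{M}}(S_\gamma)$, $\widetilde{\mathcal{A}}^u_{\mathbb{M}}(S_\gamma)$, $\widetilde{\mathcal{A}}_{\mathbb{M}}(S_\gamma)$, respectively. *)

(* Defs.v *)
From HB Require Import structures.
From mathcomp Require Import all_boot all_order all_algebra complex.
From mathcomp Require Import all_classical all_reals all_analysis.

Set Implicit Arguments.
Unset Strict Implicit.
Unset Printing Implicit Defensive.

Import Order.TTheory GRing.Theory Num.Theory.
Import numFieldNormedType.Exports.

Local Open Scope classical_set_scope.
Local Open Scope complex_scope.
Local Open Scope ring_scope.

Section Ultraholomorphic.
Context {R : realType}.

(* [R[i]^o] is [R[i]] with the topology given by the modulus. *)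
Local Notation C := (R[i]^o).

Definition weight_sequence (M : nat -> R) : Prop :=
  [/\ M 0%N = 1,
      forall p, 0 < M p,
      forall p, (1 <= p)%N -> M p ^+ 2 <= M p.-1 * M p.+1
    & M p.+1 / M p @[p --> \oo] --> +oo].

(* A point of the Riemann surface of the logarithm is given by its polar
   coordinates (|z|, arg z), with |z| > 0 and an unrestricted argument: the
   surface is the open subset [Rlog] of the plane, with the topology induced
   by the plane.  Functions on a subset of [Rlog] are represented by functions
   on [R * R], whose values off that subset never matter. *)
Definition Rlog : set (R * R) := [set z | 0 < z.1].

(* The complex number below a point of the surface. *)
Definition Rlog_proj (z : R * R) : R[i] := (z.1 * cos z.2) +i* (z.1 * sin z.2).

Definition sector (gamma : R) : set (R * R) :=
  [set z | Rlog z /\ `|z.2| < gamma * pi / 2].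

Definition bounded_sector (d alpha r : R) : set (R * R) :=
  [set z | [/\ Rlog z, `|z.2 - d| < alpha * pi / 2 & z.1 < r]].

Definition proper_subsector (T : set (R * R)) (gamma : R) : Prop :=
  exists d alpha r : R, [/\ 0 < alpha, 0 < r, T = bounded_sector d alpha r
    & closure T `&` Rlog `<=` sector gamma].

(* [l] is the derivative of [f] at the point [z] of the surface with respect
   to the local coordinate [Rlog_proj]. *)
Definition is_derivative (f : R * R -> C) (z : R * R) (l : C) : Prop :=
  ((f w - f z) / (Rlog_proj w - Rlog_proj z) : C) @[w --> z^'] --> l.

Definition holomorphic_on (S : set (R * R)) (f : R * R -> C) : Prop :=
  forall z, S z -> exists l, is_derivative f z l.

(* [F n] is the n-th derivative of [f] on [S]. *)
Definition iterated_derivatives (S : set (R * R)) (f : R * R -> C)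
    (F : nat -> R * R -> C) : Prop :=
  (forall z, S z -> F 0%N z = f z) /\
  (forall n z, S z -> is_derivative (F n) z (F n.+1 z)).

(* A formal power series is the sequence of its coefficients. *)
Definition series_class (M : nat -> R) : set (nat -> C) :=
  [set a | exists A K : R, 0 < A /\
    forall p, `|a p| <= (K * A ^+ p * M p)%:C].

Definition expansion_on (M : nat -> R) (T : set (R * R))
    (f : R * R -> C) (a : nat -> C) : Prop :=
  exists K A : R, [/\ 0 < K, 0 < A & forall z p, T z ->
    `|f z - \sum_(n < p) a n * Rlog_proj z ^+ n|
      <= (K * A ^+ p * M p * z.1 ^+ p)%:C].

Definition asymptotic_expansion (M : nat -> R) (gamma : R)
    (f : R * R -> C) (a : nat -> C) : Prop :=
  forall T, proper_subsector T gamma -> expansion_on M T f a.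

(* [class_At], [class_Atu] and [class_A] are the classes usually denoted by
   A~_M, A~^u_M and A_M on the sector of opening gamma * pi. *)
Definition class_At (M : nat -> R) (gamma : R) : set (R * R -> C) :=
  [set f | holomorphic_on (sector gamma) f /\
    exists a, asymptotic_expansion M gamma f a].

Definition class_Atu (M : nat -> R) (gamma : R) : set (R * R -> C) :=
  [set f | holomorphic_on (sector gamma) f /\
    exists a, expansion_on M (sector gamma) f a].

Definition class_A (M : nat -> R) (gamma : R) : set (R * R -> C) :=
  [set f | holomorphic_on (sector gamma) f /\
    exists F, iterated_derivatives (sector gamma) f F /\
    exists A K : R, 0 < A /\ forall n z, sector gamma z ->
      `|F n z| <= (K * A ^+ n * n`!%:R * M n)%:C].

(* The asymptotic Borel map.  All three classes are contained in [class_At],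
   on which the expansion exists and is unique, so the value 0 given to
   functions without an expansion is never used on them. *)
Definition borel (M : nat -> R) (gamma : R) (f : R * R -> C) : nat -> C :=
  xget (fun=> 0) (asymptotic_expansion M gamma f).

(* The set of openings for which the Borel map is injective on the class [A];
   members of the class are identified when they agree on the sector. *)
Definition injectivity_set (A : (nat -> R) -> R -> set (R * R -> C))
    (M : nat -> R) : set R :=
  [set gamma | 0 < gamma /\ forall f g, A M gamma f -> A M gamma g ->
    borel M gamma f = borel M gamma g ->
    forall z, sector gamma z -> f z = g z].

Definition surjectivity_set (A : (nat -> R) -> R -> set (R * R -> C))
    (M : nat -> R) : set R :=
  [set gamma | 0 < gamma /\
    set_surj (A M gamma) (series_class M) (borel M gamma)].

End Ultraholomorphic.

(* Main.v *)
Require Import Defs.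
From HB Require Import structures.
From mathcomp Require Import all_boot all_order all_algebra complex.
From mathcomp Require Import all_classical all_reals all_analysis.
From mathcomp Require Import ring lra.

(* On the two uniform classes the functions are bounded, whereas bijectivity
   would make the function f with expansion z satisfy f(2z) = 2 f(z), because
   f(2z)/2 lies in the class and has the same expansion; hence f = 0, which is
   absurd.

   On the third class the argument is a closed graph theorem (in the style of
   De Wilde).  Exhaust the sector by a sequence of proper subsectors.  If every
   series with coefficients M_p b_p, b in the unit ball of l^oo, is the
   expansion of some function, Baire's theorem gives a sequence of constants
   such that the b whose function obeys the first k of them on the first k
   subsectors are somewhere dense, for every k.  Successive approximation then
   writes every small b as the sum of a series whose functions decrease
   geometrically on each subsector; by Weierstrass' theorem the sum of these
   functions is a holomorphic function with the prescribed expansion, and it is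
   bounded on the first subsector by a constant independent of b.  By
   injectivity this applies to the monomials r M_p z^p, although M_p -> oo.

   Weierstrass' theorem is proved in the chart w = log z, where the sector is a
   horizontal strip, from Goursat's lemma and Cauchy's formula for rectangles. *)

Set Implicit Arguments.
Unset Strict Implicit.
Unset Printing Implicit Defensive.

Import Order.TTheory GRing.Theory Num.Theory.
Import numFieldNormedType.Exports.

Local Open Scope classical_set_scope.
Local Open Scope complex_scope.
Local Open Scope ring_scope.

(** * Complex moduli and integrals along segments *)


(** Dilation cannot settle the third class: its bounds hold on bounded subsectors only, and the
    points [2^n z] leave each of them. In that class the constants depend on the function and on the
    subsector. Baire's theorem is therefore applied to the coefficients, where a ball of [l^oo] is
    complete, and the constants are fixed one subsector at a time, among countably many integer
    values. Density is enough because the error left at one stage is handed to the next, which obeys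
    the constants of one more subsector. The summand of index k is thus controlled on subsectors 0
    to k only; on a given subsector the finitely many earlier summands bring constants of their own,
    which are absorbed into the final ones. The contradiction is read off at the point 1 of the
    first subsector, where [r M_p z^p] takes the value [r M_p]. In Weierstrass' theorem the limit is
    recovered as a quotient of two Cauchy integrals, so that only the nonvanishing of the kernel
    integral matters. *)

Section Modulus.
Context {R : realType}.
Implicit Types z w : R[i].

(** The norm of [R[i]] takes its values in [R[i]]; this copy takes them in [R], where the order is
    total and [lra] applies. *)
Definition cmod z : R := Num.sqrt (complex.Re z ^+ 2 + complex.Im z ^+ 2).

Lemma normcE z : `|z| = (cmod z)%:C.
Proof. exact: normc_def. Qed.

Lemma cmodP z (x : R) : `|z| = x%:C -> cmod z = x.
Proof. by rewrite normcE => -[]. Qed.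

Lemma cmod_ge0 z : 0 <= cmod z.
Proof. exact: sqrtr_ge0. Qed.

Lemma cmod0 : cmod 0 = 0.
Proof. by apply: cmodP; rewrite normr0. Qed.

Lemma cmod1 : cmod 1 = 1.
Proof. by apply: cmodP; rewrite normr1. Qed.

Lemma cmodM z w : cmod (z * w) = cmod z * cmod w.
Proof. by apply: cmodP; rewrite normrM !normcE rmorphM. Qed.

Lemma cmodV z : cmod z^-1 = (cmod z)^-1.
Proof. by apply: cmodP; rewrite normfV normcE fmorphV. Qed.

Lemma cmodX z n : cmod (z ^+ n) = cmod z ^+ n.
Proof. by apply: cmodP; rewrite normrX normcE rmorphXn. Qed.

Lemma cmodN z : cmod (- z) = cmod z.
Proof. by apply: cmodP; rewrite normrN normcE. Qed.

Lemma cmodBC z w : cmod (z - w) = cmod (w - z).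
Proof. by rewrite -cmodN opprB. Qed.

Lemma cmodD z w : cmod (z + w) <= cmod z + cmod w.
Proof. by rewrite -lecR rmorphD /= -!normcE; exact: (@ler_normD _ R[i]). Qed.

Lemma cmodB z w : cmod (z - w) <= cmod z + cmod w.
Proof. by rewrite (le_trans (cmodD _ _))// cmodN. Qed.

Lemma cmod_trans z w u : cmod (z - u) <= cmod (z - w) + cmod (w - u).
Proof. by rewrite -[z - u](subrKA w) cmodD. Qed.

Lemma cmod_eq0 z : (cmod z == 0) = (z == 0).
Proof. by rewrite -(inj_eq (@complexI R)) -normcE normr_eq0. Qed.

Lemma cmod_gt0 z : (0 < cmod z) = (z != 0).
Proof. by rewrite lt_neqAle cmod_ge0 andbT eq_sym cmod_eq0. Qed.

Lemma cmod_real (x : R) : cmod x%:C = `|x|.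
Proof. by rewrite /cmod /= expr0n addr0 sqrtr_sqr. Qed.

Lemma cmod_i : cmod 'i = 1.
Proof. by rewrite /cmod /= expr0n add0r expr1n sqrtr1. Qed.

Lemma cmod_Re z : `|complex.Re z| <= cmod z.
Proof. by rewrite -sqrtr_sqr ler_wsqrtr // lerDl sqr_ge0. Qed.

Lemma cmod_Im z : `|complex.Im z| <= cmod z.
Proof. by rewrite -sqrtr_sqr ler_wsqrtr // lerDr sqr_ge0. Qed.

Lemma cmod_le z : cmod z <= `|complex.Re z| + `|complex.Im z|.
Proof.
have h : 0 <= `|complex.Re z| + `|complex.Im z| by rewrite addr_ge0.
rewrite -[leRHS]ger0_norm // -sqrtr_sqr ler_wsqrtr // sqrrD !real_normK ?num_real //.
by rewrite addrAC lerDl mulrn_wge0 // mulr_ge0.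
Qed.

Lemma cmod_sum n (F : nat -> R[i]) :
  cmod (\sum_(i < n) F i) <= \sum_(i < n) cmod (F i).
Proof.
elim: n => [|n IH]; first by rewrite !big_ord0 cmod0.
by rewrite !big_ord_recr /= (le_trans (cmodD _ _)) // lerD2r.
Qed.

Lemma lec_cmod z (x : R) : (`|z| <= x%:C) = (cmod z <= x).
Proof. by rewrite normcE lecR. Qed.

End Modulus.

Section SegmentIntegral.
Context {R : realType}.
Local Notation C := R[i].
Local Notation leb := (@lebesgue_measure R).

Definition ccont_at (g : R -> C) (x : R) : Prop := forall e, 0 < e ->
  exists2 d, 0 < d & forall y, `|y - x| < d -> cmod (g y - g x) <= e.

Definition ccont_on (g : R -> C) (a b : R) : Prop :=
  forall x, a <= x <= b -> ccont_at g x.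

(** No orientation: for [b < a] the segment is empty and the value is 0, whence the hypotheses
    [a <= b] below. *)
Definition cint (g : R -> C) (a b : R) : C :=
  (\int[leb]_(x in `[a, b]) complex.Re (g x)) +i*
  (\int[leb]_(x in `[a, b]) complex.Im (g x)).

Lemma integrable_ptwise_continuous (u : R -> R) (a b : R) :
  (forall x, a <= x <= b -> forall e, 0 < e ->
     exists2 d, 0 < d & forall y, `|y - x| < d -> `|u y - u x| <= e) ->
  leb.-integrable `[a, b] (EFin \o u).
Proof.
move=> uc; apply: continuous_compact_integrable; first exact: segment_compact.
apply: continuous_in_subspaceT => x; rewrite inE /= in_itv /= => xab.
apply/cvgrPdist_le => e e0; have [d d0 H] := uc x xab e e0.
near=> y; rewrite distrC; apply: H.
near: y; exists d => //= y; by rewrite /ball /= distrC.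
Unshelve. all: by end_near.
Qed.

Lemma integrable_Re g a b : ccont_on g a b ->
  leb.-integrable `[a, b] (EFin \o (fun x => complex.Re (g x))).
Proof.
move=> gc; apply: integrable_ptwise_continuous => x xab e e0.
have [d d0 H] := gc x xab e e0; exists d => // y /H; apply: le_trans.
by rewrite -(raddfB (@complex.Re R : Rcomplex R -> R)) cmod_Re.
Qed.

Lemma integrable_Im g a b : ccont_on g a b ->
  leb.-integrable `[a, b] (EFin \o (fun x => complex.Im (g x))).
Proof.
move=> gc; apply: integrable_ptwise_continuous => x xab e e0.
have [d d0 H] := gc x xab e e0; exists d => // y /H; apply: le_trans.
by rewrite -(raddfB (@complex.Im R : Rcomplex R -> R)) cmod_Im.
Qed.

Lemma eq_cint g h a b : (forall x, a <= x <= b -> g x = h x) ->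
  cint g a b = cint h a b.
Proof.
by move=> gh; congr (_ +i* _); apply: eq_Rintegral => x;
  rewrite inE /= in_itv /= => /gh ->.
Qed.

Lemma cintD g h a b : ccont_on g a b -> ccont_on h a b ->
  cint (fun x => g x + h x) a b = cint g a b + cint h a b.
Proof.
move=> gc hc; apply/eqP; rewrite eq_complex /=; apply/andP; split; apply/eqP.
  rewrite -RintegralD //; try exact: integrable_Re.
  by apply: eq_Rintegral => x _; case: (g x) (h x) => ? ? [].
rewrite -RintegralD //; try exact: integrable_Im.
by apply: eq_Rintegral => x _; case: (g x) (h x) => ? ? [].
Qed.

Lemma integrableZ_EFin (u : R -> R) (a b k : R) :
  leb.-integrable `[a, b] (EFin \o u) ->
  leb.-integrable `[a, b] (EFin \o (fun x => k * u x)).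
Proof.
move=> iu; have := @integrableZl _ _ _ leb `[a, b]%classic (measurable_itv _) k _ iu.
by apply: eq_integrable.
Qed.

Lemma cintZ c g a b : ccont_on g a b ->
  cint (fun x => c * g x) a b = c * cint g a b.
Proof.
move=> gc; have iR := integrable_Re gc; have iI := integrable_Im gc.
case: c => p q.
apply/eqP; rewrite eq_complex /=; apply/andP; split; apply/eqP.
  rewrite -!RintegralZl // -RintegralB //; try exact: integrableZ_EFin.
  by apply: eq_Rintegral => x _; case: (g x).
rewrite -!RintegralZl // -RintegralD //; try exact: integrableZ_EFin.
by apply: eq_Rintegral => x _; case: (g x).
Qed.

Lemma Rintegral_itv_split (u : R -> R) a m b : a <= m <= b ->
  leb.-integrable `[a, b] (EFin \o u) ->
  \int[leb]_(x in `[a, b]) u x =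
  \int[leb]_(x in `[a, m]) u x + \int[leb]_(x in `[m, b]) u x.
Proof.
move=> /andP[am mb] iu.
have H := @Rintegral_itvB R u (BLeft a) (BRight b) m iu.
rewrite !bnd_simp in H; have {}H := H am mb.
rewrite -(@Rintegral_itv_obnd_cbnd _ m); last first.
  by apply: integrableS iu => //; apply: subset_itvr; rewrite bnd_simp.
by rewrite -H addrC subrK.
Qed.

Lemma cint_split g a m b : a <= m <= b -> ccont_on g a b ->
  cint g a b = cint g a m + cint g m b.
Proof.
move=> amb gc; have iR := integrable_Re gc; have iI := integrable_Im gc.
by rewrite /cint (Rintegral_itv_split amb iR) (Rintegral_itv_split amb iI).
Qed.

Lemma Rint_cst (a b k : R) : a <= b -> \int[leb]_(x in `[a, b]) k = k * (b - a).
Proof.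
move=> ab; rewrite Rintegral_cst //= lebesgue_measure_itv /= lte_fin.
by move: ab; rewrite le_eqVlt => /predU1P[->|->] //=; rewrite ltxx subrr.
Qed.

Lemma le_Rint (u : R -> R) (a b B : R) : a <= b ->
  leb.-integrable `[a, b] (EFin \o u) ->
  (forall x, a <= x <= b -> `|u x| <= B) ->
  `|\int[leb]_(x in `[a, b]) u x| <= B * (b - a).
Proof.
move=> ab iu uB; rewrite (le_trans (le_normr_Rintegral _ iu)) //.
rewrite -Rint_cst //; apply: le_Rintegral => //.
- exact: (integrable_norm iu).
- apply: integrable_ptwise_continuous => x _ e e0; exists 1 => // y _.
  by rewrite subrr normr0 ltW.
Qed.

(** The factor 2 comes from estimating the real and imaginary parts separately. *)
Lemma cint_bound g a b B : a <= b -> ccont_on g a b ->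
  (forall x, a <= x <= b -> cmod (g x) <= B) ->
  cmod (cint g a b) <= 2 * B * (b - a).
Proof.
move=> ab gc gB; rewrite (le_trans (cmod_le _)) //= -mulrA mulrDl mul1r lerD //.
  apply: le_Rint => //; first exact: integrable_Re.
  by move=> x /gB; apply: le_trans; exact: cmod_Re.
apply: le_Rint => //; first exact: integrable_Im.
by move=> x /gB; apply: le_trans; exact: cmod_Im.
Qed.

Lemma cint_cst c a b : a <= b -> cint (fun=> c) a b = c * (b - a)%:C.
Proof.
move=> ab; rewrite /cint !Rint_cst //; case: c => p q.
by apply/eqP; rewrite eq_complex /= !mulr0 subr0 add0r !eqxx.
Qed.

(** This integral and that of the constants give the affine case of Cauchy's theorem, from which
    Goursat's lemma starts. *)
Lemma Rint_id (a b : R) : a <= b ->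
  \int[leb]_(x in `[a, b]) x = (b ^+ 2 - a ^+ 2) / 2.
Proof.
rewrite le_eqVlt => /predU1P[->|ab].
  by rewrite set_itv1 Rintegral_set1 subrr mul0r.
rewrite /Rintegral (@continuous_FTC2 R id (fun x => x ^+ 2 / 2)) //.
- by rewrite /= mulrBl.
- by apply: continuous_subspaceT => x; exact: cvg_id.
- have D : forall x : R, derivable (fun x : R => x ^+ 2 / 2) x 1.
    move=> x; have -> : (fun x : R => x ^+ 2 / 2) = (fun x => x ^+ 2) * cst (2^-1).
      by [].
    apply: derivableM; last exact: derivable_cst.
    exact: exprn_derivable.
  have Cn (x : R) : {for x, continuous (fun x : R => x ^+ 2 / 2)}.
    by apply/differentiable_continuous/derivable1_diffP; exact: D.
  split; first by move=> x _; exact: D.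
    exact: cvg_at_right_filter (Cn a).
  exact: cvg_at_left_filter (Cn b).
- move=> x _ /=; rewrite derive1E.
  have -> : (fun x : R => x ^+ 2 / 2) = 2^-1 \*: (@GRing.exp R ^~ 2%N).
    by apply/funext => y /=; rewrite mulrC.
  rewrite deriveZ; last exact: exprn_derivable.
  rewrite exp_derive /= !scaler1 expr1 -[_ *: _]/(2^-1 * _).
  by rewrite -[2 *: x]/(2 * x) mulKf // pnatr_eq0.
Qed.

Lemma cint_id a b : a <= b ->
  cint (fun x => x%:C) a b = ((b ^+ 2 - a ^+ 2) / 2)%:C.
Proof.
move=> ab; rewrite /cint /= Rint_id // Rint_cst //.
by rewrite mul0r.
Qed.

Lemma cint_gt0 (g : R -> C) (a b k : R) : a < b -> 0 < k -> ccont_on g a b ->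
  (forall x, a <= x <= b -> k <= complex.Im (g x)) -> 0 < complex.Im (cint g a b).
Proof.
move=> ab k0 gc gk /=; apply: (@lt_le_trans _ _ (k * (b - a))).
  by rewrite mulr_gt0 // subr_gt0.
rewrite -(Rint_cst _ (ltW ab)); apply: le_Rintegral => //.
- apply: integrable_ptwise_continuous => x _ e e0; exists 1 => // y _.
  by rewrite subrr normr0 ltW.
- exact: integrable_Im.
Qed.

End SegmentIntegral.

(** * Complex differentiability and integrals along rectangles *)


Section ComplexDifferentiability.
Context {R : realType}.
Local Notation C := R[i].

Definition ccont (h : C -> C) (w : C) : Prop := forall e, 0 < e ->
  exists2 d, 0 < d & forall u, cmod (u - w) < d -> cmod (h u - h w) <= e.

Definition cdiff (h : C -> C) (w l : C) : Prop := forall e, 0 < e ->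
  exists2 d, 0 < d &
    forall u, cmod (u - w) < d -> cmod (h u - h w - l * (u - w)) <= e * cmod (u - w).

Lemma gt0_complex (z : C) : 0 < z -> 0 < complex.Re z /\ z = (complex.Re z)%:C.
Proof. by case: z => a b; rewrite ltcE /= => /andP[/eqP-> ->]. Qed.

Lemma ccontP (h : C -> C) w :
  ccont h w <-> ((h : R[i]^o -> R[i]^o) u @[u --> (w : R[i]^o)] --> (h w : R[i]^o)).
Proof.
split => [H|].
  apply/(@cvgrPdist_le _ R[i]^o _ (nbhs (w : R[i]^o)) _) => e
    /gt0_complex[e0 ->].
  have [d d0 Hd] := H _ e0.
  exists d%:C => /=; first by rewrite ltcR.
  move=> u; rewrite /ball /= normcE ltcR cmodBC => /Hd.
  by rewrite -lec_cmod distrC.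
move=> /cvgrPdist_le H e e0; have := H e%:C; rewrite ltcR => /(_ e0).
move=> [d /= /gt0_complex[d0 ->] Hd]; exists (complex.Re d) => // u ud.
by rewrite cmodBC -lec_cmod; apply: Hd; rewrite /= normcE ltcR cmodBC.
Qed.

Lemma ccontD f g w : ccont f w -> ccont g w -> ccont (fun z => f z + g z) w.
Proof.
move=> /ccontP fc /ccontP gc; apply/ccontP.
exact: (@cvgD _ R[i]^o _ (nbhs (w : R[i]^o)) _ _ _ _ _ fc gc).
Qed.

Lemma ccontM f g w : ccont f w -> ccont g w -> ccont (fun z => f z * g z) w.
Proof.
move=> /ccontP fc /ccontP gc; apply/ccontP.
exact: (@cvgM _ _ (nbhs (w : R[i]^o)) _ _ _ _ _ fc gc).
Qed.

Lemma ccontV f w : f w != 0 -> ccont f w -> ccont (fun z => (f z)^-1) w.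
Proof.
move=> f0 /ccontP fc; apply/ccontP.
exact: (@cvgV _ _ (nbhs (w : R[i]^o)) _ _ _ f0 fc).
Qed.

Lemma ccont_cst c w : ccont (fun=> c) w.
Proof. by move=> e e0; exists 1 => // u _; rewrite subrr cmod0 ltW. Qed.

Lemma ccont_id w : ccont id w.
Proof. by move=> e e0; exists e => // u /ltW. Qed.

Lemma ccontB f g w : ccont f w -> ccont g w -> ccont (fun z => f z - g z) w.
Proof.
move=> fc gc; have -> : (fun z => f z - g z) = (fun z => f z + (-1) * g z).
  by apply/funext => z; rewrite mulN1r.
by apply: ccontD => //; apply: ccontM => //; exact: ccont_cst.
Qed.

(** Carathéodory's form of differentiability: the slope extends continuously to [w]. With its
    converse below it reduces the quotient and chain rules to algebra on slopes. *)
Lemma cdiff_quotient (h : C -> C) w l : cdiff h w l ->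
  exists2 q, (forall u, h u - h w = q u * (u - w)) & q w = l /\ ccont q w.
Proof.
move=> hd; exists (fun u => if u == w then l else (h u - h w) / (u - w)).
  move=> u; case: eqVneq => [->|uw]; first by rewrite !subrr mulr0.
  by rewrite divfK // subr_eq0.
split; first by rewrite eqxx.
move=> e e0; have [d d0 H] := hd e e0; exists d => // u ud.
rewrite eqxx; case: eqVneq => [_|uw]; first by rewrite subrr cmod0 ltW.
have uw0 : u - w != 0 by rewrite subr_eq0.
rewrite -(ler_pM2r (x := cmod (u - w))) ?cmod_gt0 // -cmodM mulrBl divfK //.
exact: H.
Qed.

Lemma quotient_cdiff (h q : C -> C) w d : 0 < d ->
  (forall u, cmod (u - w) < d -> h u - h w = q u * (u - w)) -> ccont q w ->
  cdiff h w (q w).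
Proof.
move=> d0 hq qc e e0; have [r r0 H] := qc e e0.
exists (Num.min d r); first by rewrite lt_min d0.
move=> u; rewrite lt_min => /andP[ud ur].
by rewrite hq // -mulrBl cmodM ler_wpM2r ?cmod_ge0 // H.
Qed.

Lemma cdiff_ccont h w l : cdiff h w l -> ccont h w.
Proof.
move=> /cdiff_quotient[q hq [_ qc]].
have -> : h = (fun u => h w + q u * (u - w)).
  by apply/funext => u; rewrite -hq addrC subrK.
apply: ccontD; first exact: ccont_cst.
apply: ccontM => //; apply: ccontB; [exact: ccont_id|exact: ccont_cst].
Qed.

Lemma ccont_neq0 h w : ccont h w -> h w != 0 ->
  exists2 d, 0 < d & forall u, cmod (u - w) < d -> h u != 0.
Proof.
move=> hc h0; have h1 : 0 < cmod (h w) by rewrite cmod_gt0.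
have [|d d0 H] := hc (cmod (h w) / 2); first by rewrite divr_gt0.
exists d => // u /H; apply: contraPneq => ->.
by rewrite sub0r cmodN => ?; lra.
Qed.

Lemma cdiff_div f g w l m : cdiff f w l -> cdiff g w m -> g w != 0 ->
  exists k, cdiff (fun z => f z / g z) w k.
Proof.
move=> fd gd g0; have [p fp [_ pc]] := cdiff_quotient fd.
have [q gq [_ qc]] := cdiff_quotient gd.
have gc := cdiff_ccont gd; have [d d0 gn0] := ccont_neq0 gc g0.
(* The slope of [f / g], since [f u * g w - f w * g u = (p u * g w - f w * q u) * (u - w)]. *)
pose r u := (p u * g w - f w * q u) / (g u * g w).
exists (r w); apply: (quotient_cdiff d0).
  move=> u /gn0 gu0.
  have fE : f u = f w + p u * (u - w) by rewrite -fp addrC subrK.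
  have E : q u * (u - w) = g u - g w by rewrite gq.
  rewrite /r; transitivity ((p u * (u - w) * g w - f w * (q u * (u - w))) / (g u * g w)).
    by rewrite E fE; field; rewrite gu0 g0.
  by field; rewrite gu0 g0.
apply: ccontM; last first.
  by apply: ccontV; rewrite ?mulf_neq0 //; apply: ccontM => //; exact: ccont_cst.
apply: ccontB; first by apply: ccontM => //; exact: ccont_cst.
by apply: ccontM => //; exact: ccont_cst.
Qed.

Lemma cdiff_near (f g : C -> C) (w l : C) d : 0 < d ->
  (forall u, cmod (u - w) < d -> f u = g u) -> cdiff f w l -> cdiff g w l.
Proof.
move=> d0 fg fc e e0; have [r r0 H] := fc e e0.
exists (Num.min d r); first by rewrite lt_min d0.
move=> u; rewrite lt_min => /andP[ud ur].
by rewrite -!fg ?subrr ?cmod0 //; exact: H.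
Qed.

Lemma cdiff_subc c w : cdiff (fun z => z - c) w 1.
Proof.
move=> e e0; exists 1 => // u _.
have -> : u - c - (w - c) - 1 * (u - w) = 0 by ring.
by rewrite cmod0 mulr_ge0 ?cmod_ge0 ?ltW.
Qed.

Lemma cdiff_sub_cst f c w l : cdiff f w l -> cdiff (fun z => f z - c) w l.
Proof.
move=> fd e e0; have [d d0 H] := fd e e0; exists d => // u /H.
by rewrite (_ : f u - c - (f w - c) = f u - f w) //; ring.
Qed.

End ComplexDifferentiability.

Ltac complex_ring :=
  apply/eqP; rewrite eq_complex /=; apply/andP; split; apply/eqP; ring.

Section RectangleIntegral.
Context {R : realType}.
Local Notation C := R[i].
Implicit Types (f g h : C -> C).

Definition inrect (x1 x2 y1 y2 : R) (w : C) : Prop :=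
  (x1 <= complex.Re w <= x2) /\ (y1 <= complex.Im w <= y2).

Definition onrect (x1 x2 y1 y2 : R) (w : C) : Prop :=
  inrect x1 x2 y1 y2 w /\ (complex.Re w = x1 \/ complex.Re w = x2 \/
                           complex.Im w = y1 \/ complex.Im w = y2).

(* The integral of [h dz] along the boundary, counterclockwise. *)
Definition rint h (x1 x2 y1 y2 : R) : C :=
  cint (fun x => h (x +i* y1)) x1 x2 - cint (fun x => h (x +i* y2)) x1 x2
  + 'i * (cint (fun y => h (x2 +i* y)) y1 y2 - cint (fun y => h (x1 +i* y)) y1 y2).

Lemma ccont_horizontal h x y : ccont h (x +i* y) -> ccont_at (fun t => h (t +i* y)) x.
Proof.
move=> hc e e0; have [d d0 H] := hc e e0; exists d => // t td; apply: H.
suff -> : (t +i* y) - (x +i* y) = (t - x)%:C by rewrite cmod_real.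
by complex_ring.
Qed.

Lemma ccont_vertical h x y : ccont h (x +i* y) -> ccont_at (fun t => h (x +i* t)) y.
Proof.
move=> hc e e0; have [d d0 H] := hc e e0; exists d => // t td; apply: H.
suff -> : (x +i* t) - (x +i* y) = 'i * (t - y)%:C.
  by rewrite cmodM cmod_real cmod_i mul1r.
by complex_ring.
Qed.

Section Boundary.
Variables (x1 x2 y1 y2 : R).
Hypotheses (x12 : x1 <= x2) (y12 : y1 <= y2).
Notation bd := (onrect x1 x2 y1 y2).

Lemma onrect_edges (P : C -> Prop) : (forall w, bd w -> P w) ->
  [/\ forall x, x1 <= x <= x2 -> P (x +i* y1),
      forall x, x1 <= x <= x2 -> P (x +i* y2),
      forall y, y1 <= y <= y2 -> P (x1 +i* y)
    & forall y, y1 <= y <= y2 -> P (x2 +i* y)].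
Proof.
move=> H; split => t tt; apply: H; do ?split => //=; rewrite ?lexx ?x12 ?y12 //; auto.
Qed.

Lemma ccont_edges h : (forall w, bd w -> ccont h w) ->
  [/\ ccont_on (fun x => h (x +i* y1)) x1 x2, ccont_on (fun x => h (x +i* y2)) x1 x2,
      ccont_on (fun y => h (x1 +i* y)) y1 y2 & ccont_on (fun y => h (x2 +i* y)) y1 y2].
Proof.
move=> /onrect_edges[H1 H2 H3 H4]; split => t tt.
- exact/ccont_horizontal/H1.
- exact/ccont_horizontal/H2.
- exact/ccont_vertical/H3.
- exact/ccont_vertical/H4.
Qed.

Lemma eq_rint f g : (forall w, bd w -> f w = g w) ->
  rint f x1 x2 y1 y2 = rint g x1 x2 y1 y2.
Proof.
move=> /onrect_edges[H1 H2 H3 H4]; rewrite /rint.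
by congr (_ - _ + _ * (_ - _)); apply: eq_cint.
Qed.

Lemma rintD f g : (forall w, bd w -> ccont f w) -> (forall w, bd w -> ccont g w) ->
  rint (fun z => f z + g z) x1 x2 y1 y2 = rint f x1 x2 y1 y2 + rint g x1 x2 y1 y2.
Proof.
move=> /ccont_edges[f1 f2 f3 f4] /ccont_edges[g1 g2 g3 g4].
by rewrite /rint !cintD //; ring.
Qed.

Lemma rintZ c f : (forall w, bd w -> ccont f w) ->
  rint (fun z => c * f z) x1 x2 y1 y2 = c * rint f x1 x2 y1 y2.
Proof.
by move=> /ccont_edges[f1 f2 f3 f4]; rewrite /rint !cintZ //; ring.
Qed.

Lemma rintB f g : (forall w, bd w -> ccont f w) -> (forall w, bd w -> ccont g w) ->
  rint (fun z => f z - g z) x1 x2 y1 y2 = rint f x1 x2 y1 y2 - rint g x1 x2 y1 y2.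
Proof.
move=> fc gc; rewrite -mulN1r -rintZ // -rintD //.
  by apply: eq_rint => w _; rewrite mulN1r.
by move=> w bw; apply: ccontM; [exact: ccont_cst|exact: gc].
Qed.

(** Two opposite sides, each with the factor 2 of [cint_bound], give the 4. *)
Lemma rint_bound f B : (forall w, bd w -> ccont f w) ->
  (forall w, bd w -> cmod (f w) <= B) ->
  cmod (rint f x1 x2 y1 y2) <= 4 * B * ((x2 - x1) + (y2 - y1)).
Proof.
move=> /ccont_edges[f1 f2 f3 f4] /onrect_edges[b1 b2 b3 b4].
have := cint_bound x12 f1 b1; have := cint_bound x12 f2 b2.
have := cint_bound y12 f3 b3; have := cint_bound y12 f4 b4.
rewrite /rint; set I1 := cint _ _ _; set I2 := cint _ _ _; set I3 := cint _ _ _.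
set I4 := cint _ _ _ => *.
rewrite (le_trans (cmodD _ _)) // cmodM cmod_i mul1r.
have := cmodB I3 I4; have := cmodB I1 I2; have := cmodB I4 I3; have := cmodB I2 I1.
have := cmodBC I1 I2; have := cmodBC I3 I4.
lra.
Qed.

(** Goursat's lemma subtracts from [h] its first-order expansion at a point, which is such an affine
    function. *)
Lemma rint_affine a b : rint (fun z => a + b * z) x1 x2 y1 y2 = 0.
Proof.
have cc c w : ccont (fun z => c * z) w :> Prop.
  by apply: ccontM; [exact: ccont_cst|exact: ccont_id].
rewrite rintD; last 2 first.
- by move=> w _; exact: ccont_cst.
- by move=> w _; exact: cc.
rewrite rintZ; last by move=> w _; exact: ccont_id.
have r0 : rint (fun=> a) x1 x2 y1 y2 = 0.
  by rewrite /rint !cint_cst // !subrr mulr0 addr0.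
have H y : cint (fun x => x +i* y) x1 x2 =
    ((x2 ^+ 2 - x1 ^+ 2) / 2)%:C + 'i * y%:C * (x2 - x1)%:C.
  rewrite -cint_id // -cint_cst // -cintD.
  - by apply: eq_cint => x _; complex_ring.
  - move=> x _; apply: (@ccont_horizontal (fun z => (complex.Re z)%:C) x 0) => e e0.
    exists e => // u; rewrite -rmorphB cmod_real.
    rewrite -(raddfB (@complex.Re R : Rcomplex R -> R)) => /ltW.
    by apply: le_trans; exact: cmod_Re.
  - by move=> x _ e e0; exists 1 => // u _; rewrite subrr cmod0 ltW.
have V x : cint (fun y => x +i* y) y1 y2 =
    'i * ((y2 ^+ 2 - y1 ^+ 2) / 2)%:C + x%:C * (y2 - y1)%:C.
  have c1 : ccont_on (fun y : R => y%:C) y1 y2.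
    move=> y _; apply: (@ccont_vertical (fun z => (complex.Im z)%:C) 0 y) => e e0.
    exists e => // u; rewrite -rmorphB cmod_real.
    rewrite -(raddfB (@complex.Im R : Rcomplex R -> R)) => /ltW.
    by apply: le_trans; exact: cmod_Im.
  rewrite -cint_id // -cint_cst // -cintZ // -cintD.
  - by apply: eq_cint => y _; complex_ring.
  - move=> y _; apply: (@ccont_vertical (fun z => 'i * (complex.Im z)%:C) 0 y).
    apply: ccontM; first exact: ccont_cst.
    move=> e e0; exists e => // u; rewrite -rmorphB cmod_real.
    rewrite -(raddfB (@complex.Im R : Rcomplex R -> R)) => /ltW.
    by apply: le_trans; exact: cmod_Im.
  - by move=> x' _ e e0; exists 1 => // u _; rewrite subrr cmod0 ltW.
rewrite r0 add0r /rint !H !V !rmorphB.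
by have i2 := @sqr_i R; ring: i2.
Qed.

End Boundary.

Lemma onrect_in x1 x2 y1 y2 w : onrect x1 x2 y1 y2 w -> inrect x1 x2 y1 y2 w.
Proof. by case. Qed.

Lemma rint_splitx h x1 m x2 y1 y2 : x1 <= m <= x2 -> y1 <= y2 ->
  (forall w, inrect x1 x2 y1 y2 w -> ccont h w) ->
  rint h x1 x2 y1 y2 = rint h x1 m y1 y2 + rint h m x2 y1 y2.
Proof.
move=> /andP[xm mx] y12 hc; have x12 := le_trans xm mx.
have [h1 h2 _ _] := ccont_edges x12 y12 (fun w bw => hc w (onrect_in bw)).
by rewrite /rint !(@cint_split _ _ x1 m x2) ?xm ?mx //; ring.
Qed.

Lemma rint_splity h x1 x2 y1 m y2 : x1 <= x2 -> y1 <= m <= y2 ->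
  (forall w, inrect x1 x2 y1 y2 w -> ccont h w) ->
  rint h x1 x2 y1 y2 = rint h x1 x2 y1 m + rint h x1 x2 m y2.
Proof.
move=> x12 /andP[ym my] hc; have y12 := le_trans ym my.
have [_ _ h1 h2] := ccont_edges x12 y12 (fun w bw => hc w (onrect_in bw)).
by rewrite /rint !(@cint_split _ _ y1 m y2) ?ym ?my //; ring.
Qed.

End RectangleIntegral.

(** * Goursat's lemma *)


Section Bisection.
Context {R : realType}.

Lemma exists_div_exp2_lt (D d : R) : 0 < d -> exists n, D / 2 ^+ n < d.
Proof.
move=> d0; exists (Num.bound (D / d)).
rewrite ltr_pdivrMr ?exprn_gt0 // -ltr_pdivrMl // mulrC.
have [D0|D0] := leP 0 (D / d).
  rewrite (lt_le_trans (archi_boundP D0)) // -natrX ler_nat.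
  exact/ltnW/ltn_expl.
by rewrite (lt_trans D0) // exprn_gt0.
Qed.

(** The intervals [[u n, u n + L / 2^n]] are nested, and the supremum of their left ends lies in all
    of them. This serves bisection here and geometric convergence later. *)
Lemma nested_point (u : nat -> R) (L : R) : 0 <= L ->
  (forall n, u n <= u n.+1 <= u n + L / 2 ^+ n.+1) ->
  exists x, forall n, u n <= x <= u n + L / 2 ^+ n.
Proof.
move=> L0 H.
have up n k : u n <= u (n + k)%N.
  elim: k => [|k IH]; first by rewrite addn0.
  by rewrite addnS (le_trans IH) //; case/andP: (H (n + k)%N).
have dn n k : u (n + k)%N + L / 2 ^+ (n + k) <= u n + L / 2 ^+ n.
  elim: k => [|k IH]; first by rewrite addn0.
  apply: le_trans IH; rewrite addnS; case/andP: (H (n + k)%N) => _ h.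
  have E : L / 2 ^+ (n + k) = L / 2 ^+ (n + k).+1 + L / 2 ^+ (n + k).+1.
    by rewrite exprS invfM; field; rewrite expf_neq0 ?pnatr_eq0.
  by rewrite E addrA lerD2r.
have bnd n m : u m <= u n + L / 2 ^+ n.
  have [nm|/ltnW mn] := leqP n m.
    rewrite -(subnKC nm); apply: le_trans (dn n (m - n)%N).
    by rewrite lerDl divr_ge0 // exprn_ge0.
  rewrite -(subnKC mn) (le_trans (up m (n - m)%N)) //.
  by rewrite lerDl divr_ge0 // exprn_ge0.
have ne : range u !=set0 by exists (u 0%N); exists 0%N.
have ub : has_ubound (range u).
  by exists (u 0%N + L / 2 ^+ 0) => _ [m _ <-]; exact: bnd.
exists (sup (range u)) => n; apply/andP; split.
  by apply: ub_le_sup => //; exists n.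
by apply: ge_sup => // _ [m _ <-]; exact: bnd.
Qed.

End Bisection.

Section Cauchy.
Context {R : realType}.
Local Notation C := R[i].
Implicit Types (f g h : C -> C).

(** The integral is the sum over the four quarters, so one of them carries at least a fourth of the
    modulus. Sides are written [a + a] and [b + b] so that the quarters have sides [a] and [b]. *)
Lemma rint_quarter h (x y a b : R) : 0 <= a -> 0 <= b ->
  (forall w, inrect x (x + (a + a)) y (y + (b + b)) w -> ccont h w) ->
  exists x', exists y', [/\ x <= x' <= x + a, y <= y' <= y + b &
    cmod (rint h x (x + (a + a)) y (y + (b + b)))
    <= 4 * cmod (rint h x' (x' + a) y' (y' + b))].
Proof.
move=> a0 b0 hc.
have sub u v : x <= u <= x + a -> y <= v <= y + b ->
    forall w, inrect u (u + a) v (v + b) w -> inrect x (x + (a + a)) y (y + (b + b)) w.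
  by move=> /andP[? ?] /andP[? ?] w [/andP[? ?] /andP[? ?]]; split; apply/andP; split; lra.
have xs : x <= x + a <= x + (a + a) by apply/andP; split; lra.
have ys : y <= y + b <= y + (b + b) by apply/andP; split; lra.
have [xs1 xs2] := andP xs; have [ys1 ys2] := andP ys.
rewrite (rint_splitx xs (le_trans ys1 ys2)) //.
rewrite (rint_splity xs1 ys); last first.
  by move=> w [/andP[w1 w2] w3]; apply: hc; split => //; rewrite w1 (le_trans w2).
rewrite (rint_splity xs2 ys); last first.
  by move=> w [/andP[w1 w2] w3]; apply: hc; split => //; rewrite w2 (le_trans xs1).
have -> : x + (a + a) = x + a + a by rewrite addrA.
have -> : y + (b + b) = y + b + b by rewrite addrA.
have px : x <= x <= x + a by rewrite lexx lerDl.
have px' : x <= x + a <= x + a by rewrite lexx lerDl a0.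
have py : y <= y <= y + b by rewrite lexx lerDl.
have py' : y <= y + b <= y + b by rewrite lexx lerDl b0.
set I1 := rint h x _ y _; set I2 := rint h x _ _ _.
set I3 := rint h _ _ y _; set I4 := rint h _ _ _ _.
have tri : cmod (I1 + I2 + (I3 + I4)) <= cmod I1 + cmod I2 + (cmod I3 + cmod I4).
  by rewrite (le_trans (cmodD _ _)) // lerD // cmodD.
have [h1|h1] := leP (cmod (I1 + I2 + (I3 + I4))) (4 * cmod I1).
  by exists x, y.
have [h2|h2] := leP (cmod (I1 + I2 + (I3 + I4))) (4 * cmod I2).
  by exists x, (y + b).
have [h3|h3] := leP (cmod (I1 + I2 + (I3 + I4))) (4 * cmod I3).
  by exists (x + a), y.
exists (x + a), (y + b); split=> //; rewrite -/I4.
move: (cmod (_ + _)) (cmod I1) (cmod I2) (cmod I3) (cmod I4) tri h1 h2 h3.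
by clear => *; lra.
Qed.

Lemma goursat h (x1 x2 y1 y2 : R) : x1 <= x2 -> y1 <= y2 ->
  (forall w, inrect x1 x2 y1 y2 w -> exists l, cdiff h w l) ->
  rint h x1 x2 y1 y2 = 0.
Proof.
move=> x12 y12 hd.
have hc w : inrect x1 x2 y1 y2 w -> ccont h w by move=> /hd[l /cdiff_ccont].
pose L := x2 - x1; pose H := y2 - y1; pose D := L + H.
have L0 : 0 <= L by rewrite subr_ge0.
have H0 : 0 <= H by rewrite subr_ge0.
pose Q n (p : R * R) := rint h p.1 (p.1 + L / 2 ^+ n) p.2 (p.2 + H / 2 ^+ n).
pose inside n (p : R * R) := (x1 <= p.1 /\ p.1 + L / 2 ^+ n <= x2) /\
  (y1 <= p.2 /\ p.2 + H / 2 ^+ n <= y2).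
have half (K : R) n : K / 2 ^+ n = K / 2 ^+ n.+1 + K / 2 ^+ n.+1.
  by rewrite exprS invfM; field; rewrite expf_neq0 ?pnatr_eq0.
(* The premise [inside] stands under the existential, so that [choice] yields a total selection
   function; any value will do when it fails. *)
have step : forall np : nat * (R * R), exists p' : R * R, inside np.1 np.2 ->
    [/\ np.2.1 <= p'.1 <= np.2.1 + L / 2 ^+ np.1.+1,
        np.2.2 <= p'.2 <= np.2.2 + H / 2 ^+ np.1.+1 &
        cmod (Q np.1 np.2) <= 4 * cmod (Q np.1.+1 p')].
  move=> [n p] /=; have [pin|pout] := pselect (inside n p); last by exists p.
  have [|||x' [y' [hx hy hq]]] := @rint_quarter h p.1 p.2 (L / 2 ^+ n.+1) (H / 2 ^+ n.+1).
  - by rewrite divr_ge0 // exprn_ge0.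
  - by rewrite divr_ge0 // exprn_ge0.
  - rewrite -!half => w [/andP[w1 w2] /andP[w3 w4]]; apply: hc.
    case: pin => -[? ?] [? ?]; split; apply/andP; split.
    + exact: le_trans w1.
    + exact: le_trans w2 _.
    + exact: le_trans w3.
    + exact: le_trans w4 _.
  by exists (x', y') => _ /=; split => //; rewrite /Q half (half H).
have [nxt nxtP] := choice step.
pose s := fix s n := if n is m.+1 then nxt (m, s m) else (x1, y1).
have sin n : inside n (s n).
  elim: n => [|n IH] /=; first by rewrite /inside /= !expr0 !divr1 /L /H !lexx !subrKC !lexx.
  have [/= /andP[h1 h2] /andP[h3 h4] _] := nxtP (n, s n) IH.
  move: IH => [[i1 i2] [i3 i4]]; rewrite half in i2; rewrite half in i4.
  split; split; [exact: le_trans h1|lra|exact: le_trans h3|lra].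
have sq n : cmod (Q 0%N (s 0%N)) <= (2 ^+ n) ^+ 2 * cmod (Q n (s n)).
  elim: n => [|n IH]; first by rewrite expr0 expr1n mul1r.
  have [_ _ /= h4] := nxtP (n, s n) (sin n).
  apply: (le_trans IH); rewrite [2 ^+ n.+1]exprS exprMn [2 ^+ 2 * _]mulrC -[_ * 2 ^+ 2 * _]mulrA.
  rewrite ler_wpM2l ?sqr_ge0 //.
  by rewrite (_ : 2 ^+ 2 = 4) //; ring.
have [X HX] : exists X, forall n, (s n).1 <= X <= (s n).1 + L / 2 ^+ n.
  by apply: nested_point => // n; have [] := nxtP (n, s n) (sin n).
have [Y HY] : exists Y, forall n, (s n).2 <= Y <= (s n).2 + H / 2 ^+ n.
  by apply: nested_point => // n; have [] := nxtP (n, s n) (sin n).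
have Q0 : Q 0%N (s 0%N) = rint h x1 x2 y1 y2.
  by rewrite /Q /= !expr0 !divr1 /L /H !subrKC.
have [l hl] : exists l, cdiff h (X +i* Y) l.
  apply: hd; split => /=; [move: (HX 0%N)|move: (HY 0%N)]; rewrite /= expr0 divr1.
    by rewrite /L subrKC.
  by rewrite /H subrKC.
(* On the n-th rectangle, of half perimeter [D / 2^n], [h] differs from its affine part at the
   common point by at most [e * (D / 2^n)]. The integral is then at most [4 * e * (D / 2^n)^2],
   which compensates the factor [4^n] of [sq]. *)
have small e : 0 < e -> cmod (rint h x1 x2 y1 y2) <= 4 * e * D ^+ 2.
  move=> e0; have [d d0 hde] := hl e e0.
  have [n nd] := exists_div_exp2_lt D d0.
  rewrite -Q0 (le_trans (sq n)) //.
  have t0 : 0 < (2 : R) ^+ n by rewrite exprn_gt0.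
  set x := (s n).1; set y := (s n).2; set a := L / 2 ^+ n; set b := H / 2 ^+ n.
  have a0 : 0 <= a by rewrite divr_ge0 // ltW.
  have b0 : 0 <= b by rewrite divr_ge0 // ltW.
  have abD : a + b = D / 2 ^+ n by rewrite -mulrDl.
  have xa : x <= x + a by rewrite lerDl.
  have yb : y <= y + b by rewrite lerDl.
  have inr w : inrect x (x + a) y (y + b) w -> inrect x1 x2 y1 y2 w.
    move=> [/andP[w1 w2] /andP[w3 w4]]; case: (sin n) => -[i1 i2] [i3 i4].
    split; apply/andP; split.
    + exact: le_trans w1.
    + exact: le_trans w2 _.
    + exact: le_trans w3.
    + exact: le_trans w4 _.
  have near w : inrect x (x + a) y (y + b) w -> cmod (w - (X +i* Y)) <= D / 2 ^+ n.
    move=> [/andP[w1 w2] /andP[w3 w4]]; have /andP[X1 X2] := HX n.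
    have /andP[Y1 Y2] := HY n; rewrite -/x -/a in X1 X2; rewrite -/y -/b in Y1 Y2.
    rewrite -abD (le_trans (cmod_le _)) // lerD //.
      by case: w w1 w2 {w3 w4} => wr wi /= w1 w2; rewrite ler_norml; apply/andP; split; lra.
    by case: w w3 w4 {w1 w2} => wr wi /= w3 w4; rewrite ler_norml; apply/andP; split; lra.
  pose A := h (X +i* Y) - l * (X +i* Y).
  have cA w : ccont (fun z => A + l * z) w.
    by apply: ccontD; [exact: ccont_cst|apply: ccontM; [exact: ccont_cst|exact: ccont_id]].
  have EQ : Q n (s n) = rint (fun z => h z - (A + l * z)) x (x + a) y (y + b).
    rewrite rintB //; last by move=> w /onrect_in /inr /hc.
    by rewrite rint_affine // subr0.
  have BQ : cmod (Q n (s n)) <= 4 * (e * (D / 2 ^+ n)) * (D / 2 ^+ n).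
    rewrite EQ -abD.
    have -> : a + b = ((x + a) - x) + ((y + b) - y) by ring.
    apply: rint_bound => //.
      by move=> w /onrect_in /inr /hc hw; exact: ccontB.
    move=> w /onrect_in /near wn.
    have -> : h w - (A + l * w) = h w - h (X +i* Y) - l * (w - (X +i* Y)).
      by rewrite /A; ring.
    apply: (le_trans (hde w (le_lt_trans wn nd))).
    rewrite ler_wpM2l ?(ltW e0) //; apply: (le_trans wn); rewrite -abD; lra.
  rewrite -ler_pdivlMl ?exprn_gt0 // (le_trans BQ) //.
  rewrite le_eqVlt; apply/orP; left; apply/eqP.
  by field; rewrite expf_neq0 // pnatr_eq0.
apply/eqP; rewrite -cmod_eq0; apply/negP => /negP m0.
have mp : 0 < cmod (rint h x1 x2 y1 y2) by rewrite lt_neqAle eq_sym m0 cmod_ge0.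
set m := cmod _ in m0 mp small.
have D2 : 0 < 8 * (D ^+ 2 + 1) by rewrite mulr_gt0 // ltr_wpDl // sqr_ge0.
(* With this [e] the bound is below [m / 2]; the added 1 keeps the denominator positive when
   [D = 0]. *)
have := small (m / (8 * (D ^+ 2 + 1))); rewrite divr_gt0 // => /(_ isT).
apply/negP; rewrite -ltNge.
have D0 : 0 <= D ^+ 2 by exact: sqr_ge0.
have -> : 4 * (m / (8 * (D ^+ 2 + 1))) * D ^+ 2 = m * (4 * D ^+ 2 / (8 * (D ^+ 2 + 1))).
  by set K := (8 * _)^-1; ring.
rewrite -[ltRHS]mulr1 ltr_pM2l // ltr_pdivrMr // mul1r.
by move: (D ^+ 2) D0 => t t0; lra.
Qed.

End Cauchy.

(** * Cauchy's formula *)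


Section CauchyFormula.
Context {R : realType}.
Local Notation C := R[i].
Implicit Types (f g h : C -> C).

Lemma cmod_small_eq0 (z : C) (K s0 : R) : 0 < s0 ->
  (forall s, 0 < s -> s <= s0 -> cmod z <= K * s) -> z = 0.
Proof.
move=> s00 H; apply/eqP; rewrite -cmod_eq0; apply/negP => /negP z0.
have zp : 0 < cmod z by rewrite lt_neqAle eq_sym z0 cmod_ge0.
have Kp : 0 < `|K| + 1 by rewrite ltr_wpDl.
pose s := Num.min s0 (cmod z / (2 * (`|K| + 1))).
have s_gt0 : 0 < s by rewrite lt_min s00 divr_gt0 // mulr_gt0.
have := H s s_gt0; rewrite ge_min lexx => /(_ isT).
apply/negP; rewrite -ltNge (le_lt_trans (ler_wpM2r (ltW s_gt0) (ler_norm K))) //.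
apply: (@le_lt_trans _ _ (`|K| * (cmod z / (2 * (`|K| + 1))))).
  by rewrite ler_wpM2l // ge_min lexx orbT.
rewrite mulrA ltr_pdivrMr ?mulr_gt0 //.
have := normr_ge0 K; nra.
Qed.

Lemma re_sub (z w : C) : complex.Re (z - w) = complex.Re z - complex.Re w.
Proof. by case: z w => ? ? []. Qed.

Lemma im_sub (z w : C) : complex.Im (z - w) = complex.Im z - complex.Im w.
Proof. by case: z w => ? ? []. Qed.

Lemma inrect_sub (x1 x2 y1 y2 u1 u2 v1 v2 : R) w : x1 <= u1 -> u2 <= x2 ->
  y1 <= v1 -> v2 <= y2 -> inrect u1 u2 v1 v2 w -> inrect x1 x2 y1 y2 w.
Proof.
move=> a b c d [/andP[w1 w2] /andP[w3 w4]]; split; apply/andP; split.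
- exact: le_trans w1.
- exact: le_trans b.
- exact: le_trans w3.
- exact: le_trans d.
Qed.

(* [q] need not be differentiable at the centre, which is therefore enclosed in
   a small square; Goursat's lemma applies to the rest of the rectangle. *)
Lemma rint_quotient0 h (x1 x2 y1 y2 a b : R) q :
  x1 < a < x2 -> y1 < b < y2 ->
  (forall w, inrect x1 x2 y1 y2 w -> exists l, cdiff h w l) ->
  (forall u, h u - h (a +i* b) = q u * (u - (a +i* b))) -> ccont q (a +i* b) ->
  rint q x1 x2 y1 y2 = 0.
Proof.
move=> /andP[xa ax] /andP[yb by2] hd hq qc; set w0 := a +i* b in hq qc *.
have qd w : w != w0 -> inrect x1 x2 y1 y2 w -> exists l, cdiff q w l.
  move=> ww0 /hd[l hl].
  have gw : w - w0 != 0 by rewrite subr_eq0.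
  have [k hk] := cdiff_div (cdiff_sub_cst (h w0) hl) (cdiff_subc w0 w) gw.
  exists k; apply: (@cdiff_near _ _ _ w k (cmod (w - w0))) hk.
    by rewrite cmod_gt0 subr_eq0; exact: ww0.
  move=> u uw; rewrite hq mulfK // subr_eq0; apply: contraTneq uw => ->.
  by rewrite cmodBC ltxx.
have qcc w : inrect x1 x2 y1 y2 w -> ccont q w.
  have [->//|ww0] := eqVneq w w0.
  by move=> /(qd _ ww0)[l /cdiff_ccont].
have [d d0 qB] := qc 1 ltr01.
(* A square of half side [s <= d / 4] lies in the disc of radius [d] where [q] is within 1 of
   [q w0]; the other terms keep it inside the rectangle. *)
pose s0 := Num.min (d / 4) (Num.min (Num.min (a - x1) (x2 - a)) (Num.min (b - y1) (y2 - b))).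
have s00 : 0 < s0 by rewrite !lt_min !subr_gt0 xa ax yb by2 divr_gt0.
(* The 16 is the 4 of [rint_bound] times the half perimeter [4 * s] divided by [s]. *)
apply: (@cmod_small_eq0 _ (16 * (cmod (q w0) + 1)) s0) => // s sp.
rewrite /s0 !le_min => /and3P[sd /andP[sx1 sx2] /andP[sy1 sy2]].
have l1 : x1 <= a - s by lra.
have l2 : a - s <= a + s by lra.
have l3 : a + s <= x2 by lra.
have m1 : y1 <= b - s by lra.
have m2 : b - s <= b + s by lra.
have m3 : b + s <= y2 by lra.
have am : a - s < a by lra.
have ap : a < a + s by lra.
have bm : b - s < b by lra.
have bp : b < b + s by lra.
have y12 : y1 <= y2 by lra.
have c1 : x1 <= a - s <= x2 by rewrite l1 (le_trans l2).
have c2 : a - s <= a + s <= x2 by rewrite l2.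
have c3 : y1 <= b - s <= y2 by rewrite m1 (le_trans m2).
have c4 : b - s <= b + s <= y2 by rewrite m2.
rewrite (rint_splitx c1 y12) // (rint_splitx c2 y12); last first.
  by move=> w /(@inrect_sub x1 x2 y1 y2) H; apply/qcc/H.
rewrite (rint_splity l2 c3); last first.
  by move=> w /(@inrect_sub x1 x2 y1 y2) H; apply/qcc/H.
rewrite (rint_splity l2 c4); last first.
  move=> w /(@inrect_sub x1 x2 y1 y2) H; apply/qcc/H => //.
(* The left, right, bottom and top pieces avoid the centre, so only the small square remains. *)
rewrite (@goursat _ q x1 (a - s)) //; last first.
  move=> w wi; apply: qd; last by apply: inrect_sub wi => //; exact: le_trans l3.
  by apply: contraPneq wi => -> [/= /andP[_]]; rewrite leNgt am.
rewrite (@goursat _ q (a + s)) //; last first.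
  move=> w wi; apply: qd; last by apply: inrect_sub wi => //; exact: le_trans l2.
  by apply: contraPneq wi => -> [/= /andP[]]; rewrite leNgt ap.
rewrite (@goursat _ q _ _ y1) //; last first.
  move=> w wi; apply: qd; last by apply: inrect_sub wi => //; exact: le_trans m3.
  by apply: contraPneq wi => -> [_ /= /andP[_]]; rewrite leNgt bm.
rewrite (@goursat _ q _ _ (b + s)) //; last first.
  move=> w wi; apply: qd; last by apply: inrect_sub wi => //; exact: le_trans m2.
  by apply: contraPneq wi => -> [_ /= /andP[]]; rewrite leNgt bp.
rewrite !add0r !addr0.
have -> : 16 * (cmod (q w0) + 1) * s =
    4 * (cmod (q w0) + 1) * ((a + s - (a - s)) + (b + s - (b - s))) by ring.
have sub w : onrect (a - s) (a + s) (b - s) (b + s) w -> inrect x1 x2 y1 y2 w.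
  by move=> /onrect_in; exact: inrect_sub.
apply: rint_bound => //; first by move=> w /sub /qcc.
move=> w /onrect_in[/andP[w1 w2] /andP[w3 w4]].
rewrite -[q w](subrK (q w0)) (le_trans (cmodD _ _)) // addrC lerD2l.
apply: qB; rewrite (le_lt_trans (cmod_le _)) // re_sub im_sub /=.
have h1 : `|complex.Re w - a| <= s by rewrite ler_norml; apply/andP; split; lra.
have h2 : `|complex.Im w - b| <= s by rewrite ler_norml; apply/andP; split; lra.
lra.
Qed.

(** For [w] inside, its distance to the boundary; a single inequality [0 < rdist] thus says that [w]
    is interior. *)
Definition rdist (x1 x2 y1 y2 : R) (w : C) : R :=
  Num.min (Num.min (complex.Re w - x1) (x2 - complex.Re w))
          (Num.min (complex.Im w - y1) (y2 - complex.Im w)).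

Lemma rdist_le (x1 x2 y1 y2 : R) w z : onrect x1 x2 y1 y2 z ->
  rdist x1 x2 y1 y2 w <= cmod (z - w).
Proof.
move=> [_]; have := cmod_Re (z - w); have := cmod_Im (z - w); rewrite re_sub im_sub.
rewrite !ler_norml => /andP[i1 i2] /andP[r1 r2].
rewrite /rdist; case=> [|[|[]]] E; rewrite !ge_min; rewrite E in i1 i2 r1 r2 *.
- by apply/orP; left; apply/orP; left; lra.
- by apply/orP; left; apply/orP; right; lra.
- by apply/orP; right; apply/orP; left; lra.
- by apply/orP; right; apply/orP; right; lra.
Qed.

Lemma rdist_gt0 (x1 x2 y1 y2 : R) w : (0 < rdist x1 x2 y1 y2 w) =
  (x1 < complex.Re w < x2) && (y1 < complex.Im w < y2).
Proof. by rewrite /rdist !lt_min !subr_gt0. Qed.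

Section Kernel.
Variables (x1 x2 y1 y2 : R) (w0 : C).
Hypothesis w0in : 0 < rdist x1 x2 y1 y2 w0.
Notation bd := (onrect x1 x2 y1 y2).

Let x12 : x1 <= x2.
Proof. by move: w0in; rewrite rdist_gt0 => /andP[/andP[? ?] _]; lra. Qed.

Let y12 : y1 <= y2.
Proof. by move: w0in; rewrite rdist_gt0 => /andP[_ /andP[? ?]]; lra. Qed.

Lemma boundary_neq0 z : bd z -> z - w0 != 0.
Proof. by move=> /(@rdist_le _ _ _ _ w0) h; rewrite -cmod_gt0 (lt_le_trans w0in). Qed.

Lemma ccont_kernel z : bd z -> ccont (fun z => (z - w0)^-1) z.
Proof.
move=> /boundary_neq0 zw; apply: ccontV => //.
by apply: ccontB; [exact: ccont_id|exact: ccont_cst].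
Qed.

(** The difference of the two sides is the integral of the slope of [h] at [w0], which vanishes by
    [rint_quotient0]. *)
Lemma cauchy_formula h : (forall w, inrect x1 x2 y1 y2 w -> exists l, cdiff h w l) ->
  rint (fun z => h z / (z - w0)) x1 x2 y1 y2 =
  h w0 * rint (fun z => (z - w0)^-1) x1 x2 y1 y2.
Proof.
move=> hd; move: (w0in); rewrite rdist_gt0 => /andP[hx hy].
have w0E : w0 = complex.Re w0 +i* complex.Im w0 by case: (w0).
have [l hl] : exists l, cdiff h w0 l.
  by apply: hd; case/andP: hx => ? ?; case/andP: hy => ? ?; split; apply/andP; split; exact: ltW.
have [q hq [_ qc]] := cdiff_quotient hl.
have hc w : bd w -> ccont h w by move=> /onrect_in /hd[k /cdiff_ccont].
have := @rint_quotient0 h x1 x2 y1 y2 _ _ q hx hy hd; rewrite -w0E => /(_ hq qc) I0.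
apply/eqP; rewrite -subr_eq0 -rintZ //; last exact: ccont_kernel.
rewrite -rintB //.
- rewrite -[X in _ == X]I0; apply/eqP/eq_rint => // z bz.
  by rewrite -mulrBl hq mulfK // boundary_neq0.
- by move=> w bw; apply: ccontM; [exact: hc|exact: ccont_kernel].
- by move=> w bw; apply: ccontM; [exact: ccont_cst|exact: ccont_kernel].
Qed.

(* Each of the four sides contributes a positive imaginary part, so the value
   [2 i pi] need not be computed. *)
Lemma rint_kernel_neq0 : rint (fun z => (z - w0)^-1) x1 x2 y1 y2 != 0.
Proof.
have [k1 k2 k3 k4] := ccont_edges x12 y12 ccont_kernel.
suff : 0 < complex.Im (rint (fun z => (z - w0)^-1) x1 x2 y1 y2).
  by apply: contraTneq => ->; rewrite /= ltxx.
move: (w0in); rewrite rdist_gt0 => /andP[/andP[xa ax] /andP[yb by2]].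
(* [S] bounds [|z - w0|^2] on the rectangle. On each side, once the direction of travel is included,
   the imaginary part of the integrand is the distance from [w0] to the line of that side over
   [|z - w0|^2], hence at least that distance over [S]. *)
pose S := (x2 - x1) ^+ 2 + (y2 - y1) ^+ 2.
have cM (c : C) (f : R -> C) s t : ccont_on f s t -> ccont_on (fun x => c * f x) s t.
  move=> fc x xst e e0.
  have c1 : 0 < cmod c + 1 by rewrite ltr_wpDl ?cmod_ge0.
  have [d d0 H] := fc x xst (e / (cmod c + 1)) (divr_gt0 e0 c1).
  exists d => // y /H; rewrite -mulrBr cmodM => H'.
  rewrite (le_trans (ler_wpM2l (cmod_ge0 c) H')) // mulrA ler_pdivrMr //.
  by rewrite mulrC ler_pM2l // lerDl.
have E : rint (fun z => (z - w0)^-1) x1 x2 y1 y2 =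
   cint (fun x => ((x +i* y1) - w0)^-1) x1 x2 +
   cint (fun x => -1 * ((x +i* y2) - w0)^-1) x1 x2 +
   (cint (fun y => 'i * ((x2 +i* y) - w0)^-1) y1 y2 +
    cint (fun y => - 'i * ((x1 +i* y) - w0)^-1) y1 y2).
  by rewrite !cintZ // /rint; ring.
have iD (z w : C) : complex.Im (z + w) = complex.Im z + complex.Im w.
  by case: z w => ? ? [].
have bnd (x y : R) : x1 <= x <= x2 -> y1 <= y <= y2 ->
    (x - complex.Re w0) ^+ 2 + (y - complex.Im w0) ^+ 2 <= S.
  move=> /andP[? ?] /andP[? ?]; rewrite /S lerD //; rewrite -ler_sqrt ?sqr_ge0 // !sqrtr_sqr.
    by rewrite [leRHS]ger0_norm ?subr_ge0 // ler_norml; apply/andP; split; lra.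
  by rewrite [leRHS]ger0_norm ?subr_ge0 // ler_norml; apply/andP; split; lra.
have pos (c p t : R) : 0 < c -> 0 < t -> c <= p -> t <= S -> c / S <= p / t.
  move=> c0 t0 cp tS; have S0 := lt_le_trans t0 tS.
  by apply: ler_pM => //; rewrite ?invr_ge0 ?(ltW c0) ?(ltW S0) // lef_pV2.
rewrite E !iD; case: (w0) xa ax yb by2 bnd k1 k2 k3 k4 => a b xa ax yb by2 bnd k1 k2 k3 k4.
rewrite /= in xa ax yb by2 bnd.
have S0 : 0 < S.
  by rewrite /S ltr_pwDl // ?sqr_ge0 // exprn_gt0 // subr_gt0 (lt_trans xa).
have sq0 (s t : R) : s != 0 \/ t != 0 -> 0 < s ^+ 2 + t ^+ 2.
  case=> h; first by rewrite ltr_pwDl ?sqr_ge0 // exprn_even_gt0.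
  by rewrite ltr_wpDl ?sqr_ge0 // exprn_even_gt0.
have yl : y1 <= y1 <= y2 by rewrite lexx.
have yr : y1 <= y2 <= y2 by rewrite lexx y12.
have xl : x1 <= x1 <= x2 by rewrite lexx.
have xr : x1 <= x2 <= x2 by rewrite lexx x12.
apply: addr_gt0; apply: addr_gt0.
- apply: (@cint_gt0 _ _ _ _ ((b - y1) / S)) => //.
  + by lra.
  + by rewrite divr_gt0 // subr_gt0.
  move=> x xx /=; rewrite -mulNr opprB; apply: pos => //; first by rewrite subr_gt0.
    by apply: sq0; right; rewrite subr_eq0 lt_eqF.
  exact: bnd.
- apply: (@cint_gt0 _ _ _ _ ((y2 - b) / S)) => //.
  + by lra.
  + by rewrite divr_gt0 // subr_gt0.
  + exact: cM.
  move=> x xx /=; rewrite oppr0 mul0r addr0 mulrN mulN1r opprK.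
  apply: pos => //; first by rewrite subr_gt0.
    by apply: sq0; right; rewrite subr_eq0 gt_eqF.
  exact: bnd.
- apply: (@cint_gt0 _ _ _ _ ((x2 - a) / S)) => //.
  + by lra.
  + by rewrite divr_gt0 // subr_gt0.
  + exact: cM.
  move=> y yy /=; rewrite mul0r mul1r add0r.
  apply: pos => //; first by rewrite subr_gt0.
    by apply: sq0; left; rewrite subr_eq0 gt_eqF.
  exact: bnd.
- apply: (@cint_gt0 _ _ _ _ ((a - x1) / S)) => //.
  + by lra.
  + by rewrite divr_gt0 // subr_gt0.
  + exact: cM.
  move=> y yy /=; rewrite oppr0 mul0r add0r mulN1r -mulNr opprB.
  apply: pos => //; first by rewrite subr_gt0.
    by apply: sq0; left; rewrite subr_eq0 lt_eqF.
  exact: bnd.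
Qed.

(** Differentiation under the integral sign, for [g] merely continuous on the boundary: the
    first-order error of the kernel is exactly [(w - w0)^2 / ((z - w) * (z - w0)^2)]. *)
Lemma cauchy_integral_cdiff g B : (forall z, bd z -> ccont g z) ->
  (forall z, bd z -> cmod (g z) <= B) ->
  exists l, cdiff (fun w => rint (fun z => g z / (z - w)) x1 x2 y1 y2) w0 l.
Proof.
move=> gc gB; pose r := rdist x1 x2 y1 y2 w0.
exists (rint (fun z => g z / (z - w0) * (z - w0)^-1) x1 x2 y1 y2) => e e0.
pose P := x2 - x1 + (y2 - y1).
(* From [|z - w| >= r / 2] and [|z - w0| >= r] on the boundary, the kernel error is at most
   [2 / r^3] times [|w - w0|^2]. *)
pose K := 4 * (`|B| * (2 / r ^+ 3)) * P.
have P0 : 0 <= P by rewrite addr_ge0 // subr_ge0.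
have K0 : 0 <= K by rewrite !mulr_ge0 // invr_ge0 exprn_ge0 // ltW.
have K1 : 0 < K + 1 by rewrite ltr_wpDl.
exists (Num.min (r / 2) (e / (K + 1))); first by rewrite lt_min !divr_gt0.
move=> w; rewrite lt_min => /andP[wr we].
have far z : bd z -> r <= cmod (z - w0) /\ r / 2 <= cmod (z - w).
  move=> /(@rdist_le _ _ _ _ w0) h; split => //; rewrite -/r in h.
  have := cmod_trans z w w0; move: (cmod (z - w)) (cmod (z - w0)) (cmod (w - w0)) wr h.
  by move=> p q t; lra.
have c0 z : bd z -> ccont (fun z => g z / (z - w0)) z.
  by move=> bz; apply: ccontM; [exact: gc|exact: ccont_kernel].
have zw z : bd z -> z - w != 0.
  by move=> /far[_ h]; rewrite -cmod_gt0 (lt_le_trans _ h) // divr_gt0.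
have c1 z : bd z -> ccont (fun z => g z / (z - w)) z.
  move=> bz; apply: ccontM; first exact: gc.
  by apply: ccontV; [exact: zw|apply: ccontB; [exact: ccont_id|exact: ccont_cst]].
have c2 z : bd z -> ccont (fun z => g z / (z - w0) * (z - w0)^-1) z.
  by move=> bz; apply: ccontM; [exact: c0|exact: ccont_kernel].
have c3 z : bd z -> ccont (fun z => (w - w0) * (g z / (z - w0) * (z - w0)^-1)) z.
  by move=> bz; apply: ccontM; [exact: ccont_cst|exact: c2].
rewrite [_ * (w - w0)]mulrC -rintZ // -!rintB //; last first.
  by move=> z bz; apply: ccontB; [exact: c1|exact: c0].
apply: (@le_trans _ _ (K * (cmod (w - w0)) ^+ 2)); last first.
  rewrite expr2 mulrA ler_wpM2r ?cmod_ge0 //.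
  rewrite (le_trans (ler_wpM2l K0 (ltW we))) // mulrA ler_pdivrMr // mulrC.
  by rewrite ler_pM2l // lerDl.
have -> : K * cmod (w - w0) ^+ 2 = 4 * (`|B| * (2 / r ^+ 3) * cmod (w - w0) ^+ 2) * P.
  by rewrite /K; ring.
apply: rint_bound => //.
  by move=> z bz; apply: ccontB; [apply: ccontB; [exact: c1|exact: c0]|exact: c3].
move=> z bz.
have -> : g z / (z - w) - g z / (z - w0) - (w - w0) * (g z / (z - w0) * (z - w0)^-1)
    = g z * ((z - w)^-1 * ((z - w0)^-1) ^+ 2) * (w - w0) ^+ 2.
  have := zw z bz; have := boundary_neq0 bz; move: (g z) => G n0 n1.
  by field; rewrite n0 n1.
rewrite cmodM cmodM cmodM !cmodX !cmodV ler_wpM2r ?exprn_ge0 ?cmod_ge0 //.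
have [f1 f2] := far z bz.
apply: ler_pM; rewrite ?cmod_ge0 ?mulr_ge0 ?invr_ge0 ?exprn_ge0 ?invr_ge0 ?cmod_ge0 //.
  exact: le_trans (gB z bz) (ler_norm B).
have -> : 2 / r ^+ 3 = (r / 2)^-1 * r^-1 ^+ 2.
  by field; exact: lt0r_neq0.
have r0 : 0 < r by [].
apply: ler_pM; rewrite ?invr_ge0 ?exprn_ge0 ?invr_ge0 ?cmod_ge0 //.
  by rewrite lef_pV2 // posrE ?divr_gt0 // (lt_le_trans _ f2) // divr_gt0.
rewrite lerXn2r ?nnegrE ?invr_ge0 ?cmod_ge0 ?(ltW r0) //.
by rewrite lef_pV2 // posrE // (lt_le_trans r0).
Qed.

End Kernel.
End CauchyFormula.

(** * Weierstrass' theorem *)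


Section Weierstrass.
Context {R : realType}.
Local Notation C := R[i].

Definition square (w : C) (r : R) : C -> Prop :=
  inrect (complex.Re w - r) (complex.Re w + r) (complex.Im w - r) (complex.Im w + r).

Lemma squareP (w z : C) r : square w r z <->
  (`|complex.Re z - complex.Re w| <= r /\ `|complex.Im z - complex.Im w| <= r).
Proof.
by rewrite /square /inrect !ler_norml; split => -[/andP[? ?] /andP[? ?]];
  split; apply/andP; split; lra.
Qed.

Lemma square_near (w z u : C) r s : square w r z -> cmod (u - z) <= s ->
  square w (r + s) u.
Proof.
move=> /squareP[h1 h2] us; apply/squareP.
have := cmod_Re (u - z); have := cmod_Im (u - z); rewrite re_sub im_sub => i1 i2.
split; [rewrite -(subrKA (complex.Re z))|rewrite -(subrKA (complex.Im z))];
  rewrite (le_trans (ler_normD _ _)) // addrC lerD //; exact: le_trans us.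
Qed.

Lemma uniform_limit_ccont (h : nat -> C -> C) (g : C -> C) (Q : C -> Prop) w d :
  0 < d -> (forall u, cmod (u - w) < d -> Q u) -> (forall N, ccont (h N) w) ->
  (forall e, 0 < e -> exists N, forall z, Q z -> cmod (h N z - g z) <= e) ->
  ccont g w.
Proof.
move=> d0 dQ hc hg e e0; have e3 : 0 < e / 3 by rewrite divr_gt0.
have [N HN] := hg _ e3; have [r r0 Hr] := hc N _ e3.
exists (Num.min d r); first by rewrite lt_min d0.
move=> u; rewrite lt_min => /andP[ud ur].
have a1 := HN u (dQ u ud); have a2 := Hr u ur.
have a3 : cmod (h N w - g w) <= e / 3 by apply/HN/dQ; rewrite subrr cmod0.
have := cmod_trans (g u) (h N u) (g w); have := cmod_trans (h N u) (h N w) (g w).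
rewrite cmodBC in a1.
move: (cmod _) (cmod (g u - h N u)) (cmod _) (cmod _) (cmod (g u - g w)) a1 a2 a3.
by move=> *; lra.
Qed.

(** Passing to the limit in Cauchy's formula gives [g w * c w = J g w] near [w0], with [c] the
    kernel integral. Both [J g] and [c] are Cauchy integrals of continuous functions, hence
    differentiable, and [c w0] is nonzero. The larger square leaves room for [g] to be continuous up
    to the boundary of the smaller one. *)
Lemma weierstrass (h : nat -> C -> C) (g : C -> C) (w0 : C) (r B : R) : 0 < r ->
  (forall N w, square w0 (r + r) w -> exists l, cdiff (h N) w l) ->
  (forall e, 0 < e -> exists N, forall w, square w0 (r + r) w -> cmod (h N w - g w) <= e) ->
  (forall w, square w0 (r + r) w -> cmod (g w) <= B) ->
  exists l, cdiff g w0 l.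
Proof.
move=> r0 hd hg gB.
pose a := complex.Re w0; pose b := complex.Im w0.
have sub w : square w0 r w -> square w0 (r + r) w.
  by move=> /squareP[? ?]; apply/squareP; split; lra.
have gc w : square w0 r w -> ccont g w.
  move=> ws; apply: (@uniform_limit_ccont h g (square w0 (r + r)) w r) => //.
    by move=> u /ltW; exact: square_near.
  by move=> N; have [l /cdiff_ccont] := hd N w (sub w ws).
pose J (f : C -> C) w := rint (fun z => f z / (z - w)) (a - r) (a + r) (b - r) (b + r).
pose c w := rint (fun z => (z - w)^-1) (a - r) (a + r) (b - r) (b + r).
have w0in : 0 < rdist (a - r) (a + r) (b - r) (b + r) w0.
  by rewrite rdist_gt0 -/a -/b; apply/andP; split; apply/andP; split; lra.
have ab : a - r <= a + r by lra.
have bb : b - r <= b + r by lra.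
have bs z : onrect (a - r) (a + r) (b - r) (b + r) z -> square w0 r z by move=> /onrect_in.
have ident w : cmod (w - w0) < r -> g w * c w = J g w.
  move=> wr; have := cmod_Re (w - w0); have := cmod_Im (w - w0).
  rewrite re_sub im_sub => i1 i2.
  have win : 0 < rdist (a - r) (a + r) (b - r) (b + r) w.
    have := le_lt_trans i1 wr; have := le_lt_trans i2 wr; rewrite !ltr_norml -/a -/b.
    move=> /andP[? ?] /andP[? ?].
    by rewrite rdist_gt0; apply/andP; split; apply/andP; split; lra.
  have ws : square w0 r w.
    by apply/squareP; split; [exact: le_trans i2 (ltW wr)|exact: le_trans i1 (ltW wr)].
  set rw := rdist _ _ _ _ w in win.
  apply/eqP; rewrite -subr_eq0; apply/eqP.
  pose P := (a + r - (a - r)) + (b + r - (b - r)).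
  (* If [h N] is within [s] of [g], replacing one by the other changes [g w * c w] by at most
     [s * cmod (c w)] and [J g w] by at most [4 * (s / rw) * P]. *)
  apply: (@cmod_small_eq0 _ _ (cmod (c w) + 4 * rw^-1 * P) 1) => // s s0 _.
  have [N HN] := hg s s0.
  have E : J (h N) w = h N w * c w.
    by apply: cauchy_formula => // z zs; apply/hd/sub.
  have hc z : onrect (a - r) (a + r) (b - r) (b + r) z -> ccont (h N) z.
    by move=> /bs/sub/(hd N)[l /cdiff_ccont].
  have kc z := @ccont_kernel _ _ _ _ _ _ win z.
  have E2 : J (h N) w - J g w =
      rint (fun z => (h N z - g z) / (z - w)) (a - r) (a + r) (b - r) (b + r).
    rewrite /J -(rintB ab bb); first by apply: (eq_rint ab bb) => z _; rewrite mulrBl.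
      by move=> z bz; apply: ccontM; [exact: hc|exact: kc].
    by move=> z bz; apply: ccontM; [exact/gc/bs|exact: kc].
  have -> : g w * c w - J g w = (J (h N) w - J g w) - (h N w - g w) * c w.
    by rewrite E; ring.
  rewrite (le_trans (cmodB _ _)) // [leRHS]mulrDl addrC lerD //.
    by rewrite cmodM mulrC ler_wpM2l ?cmod_ge0 //; apply/HN/sub.
  have -> : 4 * rw^-1 * P * s = 4 * (s * rw^-1) * P by ring.
  rewrite E2; apply: rint_bound => //.
  - move=> z bz; apply: ccontM; last exact: kc.
    by apply: ccontB; [exact: hc|exact/gc/bs].
  move=> z bz; rewrite cmodM cmodV; apply: ler_pM; rewrite ?invr_ge0 ?cmod_ge0 //.
    exact/HN/sub/bs.
  have hz := rdist_le w bz; rewrite lef_pV2 // posrE; exact: lt_le_trans hz.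
have [l hl] := cauchy_integral_cdiff w0in (fun z bz => gc z (bs z bz))
   (fun z bz => gB z (sub z (bs z bz))).
(* [c] is the Cauchy integral of the constant 1. *)
have c11 : cmod (1 : C) <= 1 by rewrite cmod1.
have [m hm] := @cauchy_integral_cdiff _ _ _ _ _ _ w0in (fun=> 1) 1
   (fun z _ => ccont_cst 1 z) (fun _ _ => c11).
have cE : (fun w => rint (fun z => 1 / (z - w)) (a - r) (a + r) (b - r) (b + r)) = c.
  by apply/funext => w; apply: (eq_rint ab bb) => z _; rewrite mul1r.
rewrite -/a -/b cE in hm; have c0 : c w0 != 0 by exact: rint_kernel_neq0.
have [k hk] := cdiff_div hl hm c0; exists k.
have [d d0 cn0] := ccont_neq0 (cdiff_ccont hm) c0.
apply: (@cdiff_near _ _ _ w0 k (Num.min d r)) hk; first by rewrite lt_min d0.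
move=> u; rewrite lt_min => /andP[ud ur].
by rewrite -[X in X / _]/(J g u) -ident // mulfK // cn0.
Qed.

End Weierstrass.

(** * The logarithmic chart *)


Section LogarithmicChart.
Context {R : realType}.
Local Notation C := R[i].

Lemma is_derive_expansion (f : R -> R) (x l : R) : is_derive x 1 f l ->
  forall e, 0 < e -> exists2 d, 0 < d &
    forall h, `|h| < d -> `|f (x + h) - f x - l * h| <= e * `|h|.
Proof.
move=> [fd fl] e e0; have : h^-1 *: ((f \o shift x) (h *: (1 : R)) - f x) @[h --> 0^'] --> l.
  by rewrite -fl; exact: fd.
move=> /cvgrPdist_le /(_ _ e0)[d /= d0 H]; exists d => // h hd.
have [->|h0] := eqVneq h 0; first by rewrite addr0 mulr0 subrr subr0 normr0 mulr0.
have := H h; rewrite /= sub0r normrN => /(_ hd h0).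
rewrite -[h *: 1]/(h * 1) mulr1 [h + x]addrC -[_ *: _]/(_ * _) => H'.
have -> : f (x + h) - f x - l * h = - ((l - h^-1 * (f (x + h) - f x)) * h) by field.
by rewrite normrN normrM ler_wpM2r.
Qed.

(** The complex exponential, obtained as [Rlog_proj] read in the chart: the point with coordinates
    [(expR x, y)] has logarithm [x +i* y]. *)
Definition cexp (w : C) : C := Rlog_proj (expR (complex.Re w), complex.Im w).

Lemma cexpD z w : cexp (z + w) = cexp z * cexp w.
Proof.
case: z w => a b [c d]; rewrite /cexp /Rlog_proj /= expRD sinD cosD.
complex_ring.
Qed.

Lemma cexp_neq0 w : cexp w != 0.
Proof.
have : cexp w * cexp (- w) != 0.
  rewrite -cexpD subrr /cexp /Rlog_proj /= expR0 cos0 sin0 mul1r mulr0.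
  exact: oner_neq0.
by apply: contra_neq => ->; rewrite mul0r.
Qed.

Lemma cexp0 : cexp 0 = 1.
Proof. by rewrite /cexp /Rlog_proj /= expR0 cos0 sin0 mul1r mulr0. Qed.

Lemma cexp_cdiff0 : cdiff cexp 0 1.
Proof.
(* The error splits into four terms [n1] to [n4], worth 1, 2, 2 and 1 times [e / 6 * m]. The
   conditions [|a| < 1 / 2] and [|a| < e / 12] serve the factors [1 + a], [expR a] and
   [expR a - 1]. *)
move=> e e0; have e6 : 0 < e / 6 by rewrite divr_gt0.
have [d1 d10 H1] := is_derive_expansion (is_derive_expR (0 : R)) e6.
have [d2 d20 H2] := is_derive_expansion (is_derive_cos (0 : R)) e6.
have [d3 d30 H3] := is_derive_expansion (is_derive_sin (0 : R)) e6.
have [d4 d40 H4] := is_derive_expansion (is_derive_expR (0 : R)) ltr01.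
pose d := Num.min (Num.min (Num.min d1 d2) (Num.min d3 d4)) (Num.min (e / 12) (1 / 2)).
exists d; first by rewrite !lt_min d10 d20 d30 d40 !divr_gt0.
move=> [a b]; rewrite subr0 => ud; rewrite cexp0 mul1r.
have ad := le_lt_trans (cmod_Re (a +i* b)) ud.
have bd := le_lt_trans (cmod_Im (a +i* b)) ud.
have ua := cmod_Re (a +i* b); have ub := cmod_Im (a +i* b).
set m := cmod (a +i* b) in ud ua ub *.
rewrite /= in ad bd ua ub.
move: ad; rewrite /d !lt_min => /andP[/andP[/andP[a1 a2] /andP[a3 a4]] /andP[a5 a6]].
move: bd; rewrite /d !lt_min => /andP[/andP[/andP[b1 b2] /andP[b3 b4]] /andP[b5 b6]].
have := H1 a a1; have := H2 b b2; have := H3 b b3; have := H4 a a4.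
rewrite !add0r expR0 cos0 sin0 !(oppr0, mul0r, addr0, subr0, mul1r) => K4 K3 K2 K1.
apply: (le_trans (cmod_le _)).
have cb := cos_max b.
have -> : complex.Re (cexp (a +i* b) - 1 - a +i* b) =
    (expR a - 1 - a) * cos b + (1 + a) * (cos b - 1).
  by rewrite /cexp /Rlog_proj /=; ring.
have -> : complex.Im (cexp (a +i* b) - 1 - a +i* b) =
    (1 + a + (expR a - 1 - a)) * (sin b - b) + (a + (expR a - 1 - a)) * b.
  by rewrite /cexp /Rlog_proj /=; ring.
have m0 : 0 <= m by exact: cmod_ge0.
have n1 : `|(expR a - 1 - a) * cos b| <= e / 6 * m.
  rewrite normrM -[leRHS]mulr1; apply: ler_pM => //.
  by rewrite (le_trans K1) // ler_wpM2l // ltW.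
have n2 : `|(1 + a) * (cos b - 1)| <= 2 * (e / 6 * m).
  rewrite normrM; apply: ler_pM => //.
    by rewrite (le_trans (ler_normD _ _)) // normr1; lra.
  by rewrite (le_trans K2) // ler_wpM2l // ltW.
have n3 : `|(1 + a + (expR a - 1 - a)) * (sin b - b)| <= 2 * (e / 6 * m).
  rewrite normrM; apply: ler_pM => //.
    rewrite (le_trans (ler_normD _ _)) // -[leRHS]/(1 + 1).
    have := ler_normD 1 a; rewrite normr1; move: K4 a6; lra.
  by rewrite (le_trans K3) // ler_wpM2l // ltW.
have n4 : `|(a + (expR a - 1 - a)) * b| <= e / 6 * m.
  rewrite normrM; apply: ler_pM => //.
  by rewrite (le_trans (ler_normD _ _)) //; move: K4 a5; lra.
apply: (le_trans (lerD (ler_normD _ _) (ler_normD _ _))).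
apply: (le_trans (lerD (lerD n1 n2) (lerD n3 n4))).
by rewrite le_eqVlt; apply/orP; left; apply/eqP; field.
Qed.

Lemma cexp_cdiff w : cdiff cexp w (cexp w).
Proof.
move=> e e0; have cw : 0 < cmod (cexp w) by rewrite cmod_gt0 cexp_neq0.
have [d d0 H] := cexp_cdiff0 (divr_gt0 e0 cw); exists d => // u ud.
have := H (u - w); rewrite subr0 => /(_ ud); rewrite cexp0 mul1r => H'.
have -> : cexp u - cexp w - cexp w * (u - w) = cexp w * (cexp (u - w) - 1 - (u - w)).
  by rewrite !mulrBr mulr1 -cexpD; congr (_ - _ - _); congr cexp; ring.
by rewrite cmodM -ler_pdivlMl // mulrA [_^-1 * e]mulrC.
Qed.

Lemma is_derivativeP (f : R * R -> R[i]^o) (z : R * R) (l : R[i]^o) :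
  is_derivative f z l <-> forall e, 0 < e -> exists2 d, 0 < d &
    forall z' : R * R, `|z'.1 - z.1| < d -> `|z'.2 - z.2| < d -> z' != z ->
      cmod ((f z' - f z) / (Rlog_proj z' - Rlog_proj z) - l) <= e.
Proof.
split => [H e e0|H].
  have /cvgrPdist_le/(_ e%:C) := H; rewrite ltcR => /(_ e0).
  move=> /nbhs_ballP[d /= d0 Hd]; exists d => // z' h1 h2 zz.
  rewrite -lec_cmod distrC; apply: (Hd z') => //.
  by split; rewrite /ball /= distrC.
apply/(@cvgrPdist_le _ R[i]^o _ (dnbhs z) _) => e /gt0_complex[e0 ->].
have [d d0 Hd] := H _ e0; apply/nbhs_ballP; exists d => //= z' [/= h1 h2] zz.
by rewrite distrC lec_cmod; apply: Hd => //; rewrite distrC.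
Qed.

Definition log_chart (f : R * R -> R[i]^o) (w : C) : C :=
  f (expR (complex.Re w), complex.Im w).

Lemma expR_near (x d : R) : 0 < d -> exists2 r, 0 < r &
  forall y, `|y - x| < r -> `|expR y - expR x| < d.
Proof.
move=> d0; have /cvgrPdist_lt /(_ _ d0)[r /= r0 H] := @continuous_expR R x.
by exists r => // y yx; rewrite distrC; apply: H; rewrite /= distrC.
Qed.

Lemma ln_near (x d : R) : 0 < x -> 0 < d -> exists2 r, 0 < r &
  forall y, `|y - x| < r -> `|ln y - ln x| < d.
Proof.
move=> x0 d0; have /cvgrPdist_lt /(_ _ d0)[r /= r0 H] := @continuous_ln R x x0.
by exists r => // y yx; rewrite distrC; apply: H; rewrite /= distrC.
Qed.

(** Chain rule by slopes: near [w] the slope [p] of [cexp] is nonzero, so the slope of [f] in the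
    coordinate [Rlog_proj] makes sense and is multiplied by [p]. The converse below divides by
    [p]. *)
Lemma cdiff_log_chart f w l :
  is_derivative f (expR (complex.Re w), complex.Im w) l ->
  exists k, cdiff (log_chart f) w k.
Proof.
move=> /is_derivativeP H.
have [p hp [pw pc]] := cdiff_quotient (cexp_cdiff w).
have p0 : p w != 0 by rewrite pw cexp_neq0.
have [d d0 pn0] := ccont_neq0 pc p0.
pose q u := if u == w then l
  else (log_chart f u - log_chart f w) / (cexp u - cexp w).
exists (q w * p w); apply: (@quotient_cdiff _ _ (fun u => q u * p u) w d) => //.
  move=> u ud; rewrite /q; case: eqVneq => [->|uw]; first by rewrite !subrr mulr0.
  have hne : cexp u - cexp w != 0 by rewrite hp mulf_neq0 ?pn0 // subr_eq0.
  by rewrite -mulrA -hp divfK.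
apply: ccontM => // e e0; have [r r0 Hr] := H e e0.
have [s s0 Hs] := expR_near (complex.Re w) r0.
exists (Num.min r s); first by rewrite lt_min r0.
move=> u; rewrite lt_min => /andP[ur us]; rewrite /q eqxx.
case: eqVneq => [_|uw]; first by rewrite subrr cmod0 ltW.
have := cmod_Re (u - w); have := cmod_Im (u - w); rewrite re_sub im_sub => i1 i2.
apply: Hr => /=.
- exact: Hs (le_lt_trans i2 us).
- exact: le_lt_trans i1 ur.
apply: contra_neq uw => -[/expR_inj h1 h2].
by case: u h1 h2 {ur us i1 i2} => a b; case: (w) => c d' /= -> ->.
Qed.

Lemma is_derivative_log_chart f (z : R * R) k : Rlog z ->
  cdiff (log_chart f) (ln z.1 +i* z.2) k -> exists l, is_derivative f z l.
Proof.
move=> z0; set w := ln z.1 +i* z.2 => hd.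
have [q hq [qw qc]] := cdiff_quotient hd.
have [p hp [pw pc]] := cdiff_quotient (cexp_cdiff w).
have p0 : p w != 0 by rewrite pw cexp_neq0.
have [d d0 pn0] := ccont_neq0 pc p0.
exists (q w / p w); apply/is_derivativeP => e e0.
have /(_ _ e0)[r r0 Hr] := ccontM qc (ccontV p0 pc).
(* Half of the radius goes to each of the coordinates [ln z'.1] and [z'.2]. The bound by [z.1] below
   keeps [z'.1] positive, where [ln] inverts [expR]. *)
pose m := Num.min d r / 2.
have m0 : 0 < m by rewrite divr_gt0 // lt_min d0.
have [s s0 Hs] := ln_near z0 m0.
exists (Num.min (Num.min s z.1) m); first by rewrite !lt_min s0 m0 !andbT.
move=> z'; rewrite !lt_min => /andP[/andP[h1 h1'] _] /andP[_ h2] zz.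
have z'0 : 0 < z'.1 by move: h1'; rewrite ltr_norml => /andP[]; lra.
pose u := ln z'.1 +i* z'.2.
have um : cmod (u - w) < Num.min d r.
  rewrite (le_lt_trans (cmod_le _)) // re_sub im_sub /=.
  have := Hs _ h1; move: h2; rewrite /m; move: (Num.min d r) => t; lra.
move: um; rewrite lt_min => /andP[ud ur].
have uw : u != w.
  apply: contra_neq zz => -[/ln_inj h3 h4].
  case: z z' h3 h4 z0 z'0
    {w hd q hq qw qc p hp pw pc p0 pn0 Hr Hs h1 h1' h2 u ud ur}
    => a b [a' b'] /= h3 -> a0 a'0.
  by rewrite h3 // posrE.
have fE : f z' - f z = q u * (u - w).
  by rewrite -hq /log_chart /= !lnK ?posrE //; case: (z') (z) => ? ? [].
have eE : Rlog_proj z' - Rlog_proj z = p u * (u - w).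
  by rewrite -hp /cexp /= !lnK ?posrE //; case: (z') (z) => ? ? [].
have uw0 : u - w != 0 by rewrite subr_eq0.
rewrite fE eE (_ : _ / _ = q u / p u); first exact: Hr.
by field; rewrite uw0 pn0.
Qed.

Lemma sector_weierstrass (gamma : R) (f : nat -> R * R -> R[i]^o) (g : R * R -> R[i]^o) :
  (forall N, holomorphic_on (sector gamma) (f N)) ->
  (forall rho theta, theta < gamma * pi / 2 ->
    (forall e, 0 < e -> exists N, forall z : R * R, 0 < z.1 < rho -> `|z.2| < theta ->
       cmod (f N z - g z) <= e) /\
    (exists B, forall z : R * R, 0 < z.1 < rho -> `|z.2| < theta -> cmod (g z) <= B)) ->
  holomorphic_on (sector gamma) g.
Proof.
move=> fh fg z [z0 zg]; pose w0 := ln z.1 +i* z.2.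
(* A quarter of the angular gap: the square of half side [2 * r] has arguments strictly below
   [|z.2| + 3 * r], still inside the sector. *)
pose r := (gamma * pi / 2 - `|z.2|) / 4.
have r0 : 0 < r by rewrite divr_gt0 // subr_gt0.
have th : `|z.2| + 3 * r < gamma * pi / 2.
  by rewrite /r; move: (gamma * pi / 2) `|z.2| zg => s t; lra.
have [Hlim [B HB]] := fg (expR (ln z.1 + 3 * r)) _ th.
have inT w : square w0 (r + r) w -> 0 < expR (complex.Re w) < expR (ln z.1 + 3 * r) /\
    `|complex.Im w| < `|z.2| + 3 * r.
  move=> /squareP[/= h1 h2]; split.
    by rewrite expR_gt0 ltr_expR; move: h1; rewrite ler_norml => /andP[]; lra.
  rewrite -[complex.Im w](subrK z.2) (le_lt_trans (ler_normD _ _)) //.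
  by move: h2 r0; lra.
have [k hk] : exists k, cdiff (log_chart g) w0 k.
  apply: (@weierstrass _ (fun N => log_chart (f N)) _ w0 r B) => //.
  - move=> N w /inT[h1 h2]; have [|l] := fh N (expR (complex.Re w), complex.Im w).
      by split; [rewrite /Rlog /= expR_gt0|exact: lt_trans th].
    exact: cdiff_log_chart.
  - by move=> e /Hlim[N HN]; exists N => w /inT[h1 h2]; exact: HN.
  - by move=> w /inT[h1 h2]; exact: HB.
exact: is_derivative_log_chart hk.
Qed.

End LogarithmicChart.

(** * Baire category and the exhaustion by cones *)


Section BoxBaire.
Context {R : realType}.
Implicit Types (E : set (nat -> R)) (c x : nat -> R).

Definition in_box c (r : R) x : Prop := forall p, `|x p - c p| <= r.

Definition sub_box c' (r' : R) c (r : R) : Prop := forall p, `|c' p - c p| + r' <= r.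

(** Nowhere density for the uniform metric, phrased with closed balls given by centre and radius;
    [sub_box] is inclusion of such balls. *)
Definition nowhere_dense E : Prop := forall c r, 0 < r ->
  exists c' r', [/\ 0 < r', sub_box c' r' c r & forall x, in_box c' r' x -> ~ E x].

Definition meager E : Prop := exists F : nat -> set (nat -> R),
  (forall i, nowhere_dense (F i)) /\ E `<=` \bigcup_i F i.

Lemma meager_bigcup E (G : nat -> set (nat -> R)) : (forall n, meager (G n)) ->
  E `<=` \bigcup_n G n -> meager E.
Proof.
move=> /choice[F HF] EG.
pose F' m := if @unpickle (nat * nat)%type m is Some ni then F ni.1 ni.2 else set0.
exists F'; split.
  move=> m; rewrite /F'; case: unpickle => [[n i]|].
    by have [H _] := HF n; exact: H.
  move=> c r r0; exists c, r; split => [//|p|x _ []].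
  by rewrite subrr normr0 add0r.
move=> x /EG[n _ xG]; have [_ /(_ _ xG)[i _ xF]] := HF n.
by exists (pickle (n, i)) => //; rewrite /F' pickleK.
Qed.

(* Balls of [l^oo] are products of intervals, so a decreasing sequence of balls
   has a common point even if the radii do not tend to [0]. *)
Lemma unit_box_nonmeager : ~ meager [set x : nat -> R | forall p, `|x p| <= 1].
Proof.
move=> [F [Fnd FE]].
have step : forall ncr : nat * ((nat -> R) * R), exists cr' : (nat -> R) * R,
    0 < ncr.2.2 -> [/\ 0 < cr'.2, sub_box cr'.1 cr'.2 ncr.2.1 ncr.2.2 &
      forall x, in_box cr'.1 cr'.2 x -> ~ F ncr.1 x].
  move=> [n [c r]] /=; have [r0|r0] := ltP 0 r; last by exists (c, r).
  by have [c' [r' H]] := Fnd n c r r0; exists (c', r').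
have [nxt nxtP] := choice step.
pose s := fix s n := if n is m.+1 then nxt (m, s m) else ((fun=> 0) : nat -> R, 1 : R).
have s0 n : 0 < (s n).2.
  by elim: n => [|n IH] //=; have [] := nxtP (n, s n) IH.
have sS n : sub_box (s n.+1).1 (s n.+1).2 (s n).1 (s n).2.
  by have [] := nxtP (n, s n) (s0 n).
have sF n x : in_box (s n.+1).1 (s n.+1).2 x -> ~ F n x.
  by have [_ _] := nxtP (n, s n) (s0 n); exact.
have mono n k p : (s n).1 p - (s n).2 <= (s (n + k)%N).1 p - (s (n + k)%N).2 /\
    (s (n + k)%N).1 p + (s (n + k)%N).2 <= (s n).1 p + (s n).2.
  elim: k => [|k [IH1 IH2]]; first by rewrite addn0.
  have := sS (n + k)%N p; rewrite addnS.
  have := ler_norm ((s (n + k).+1).1 p - (s (n + k)%N).1 p).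
  have := ler_norm (- ((s (n + k).+1).1 p - (s (n + k)%N).1 p)); rewrite normrN.
  by move: `|_| => t; move: (s (n + k).+1) (s (n + k)%N) (s n) IH1 IH2 => [? ?] [? ?] [? ?] /=; lra.
have bnd n m p : (s m).1 p - (s m).2 <= (s n).1 p + (s n).2.
  have [nm|/ltnW mn] := leqP n m.
    have [_ h] := mono n (m - n)%N p; rewrite subnKC // in h.
    by have := s0 m; lra.
  have [h _] := mono m (n - m)%N p; rewrite subnKC // in h.
  by have := s0 n; lra.
pose x p := sup (range (fun n => (s n).1 p - (s n).2)).
have xin n : in_box (s n).1 (s n).2 x.
  move=> p; rewrite ler_distl; apply/andP; split.
    apply: ub_le_sup; last by exists n.
    by exists ((s 0%N).1 p + (s 0%N).2) => _ [m _ <-]; exact: bnd.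
  apply: ge_sup; last by move=> _ [m _ <-]; exact: bnd.
  by exists ((s 0%N).1 p - (s 0%N).2); exists 0%N.
have [|i _ Fx] := FE x; last exact: sF (xin i.+1) Fx.
by move=> p; have := xin 0%N p; rewrite /= subr0.
Qed.

(** Otherwise [E] is itself nowhere dense, and the constant family covers it. *)
Lemma nonmeager_somewhere_dense E : ~ meager E -> exists c r, 0 < r /\
  forall c' r', 0 < r' -> sub_box c' r' c r -> exists2 x, E x & in_box c' r' x.
Proof.
move=> Em; apply: contrapT => H; apply: Em; exists (fun=> E); split; last first.
  by move=> x Ex; exists 0%N.
move=> _ c r r0; apply: contrapT => H'; apply: H; exists c, r; split => // c' r' r'0 sb.
apply: contrapT => H''; apply: H'; exists c', r'; split => // x xb Ex.
by apply: H''; exists x.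
Qed.

End BoxBaire.

(** * Limits of geometrically convergent sequences *)

Section GeometricLimit.
Context {R : realType}.

Lemma geometric_limit_real (v : nat -> R) (K : R) : 0 <= K ->
  (forall n, `|v n.+1 - v n| <= K / 2 ^+ n) ->
  exists x, forall n, `|v n - x| <= 2 * K / 2 ^+ n.
Proof.
(* Left ends of the nested intervals of centre [v n] and length [4 * K / 2^n]. *)
move=> K0 H; pose w n := v n - 2 * K / 2 ^+ n.
have half n : K / 2 ^+ n = 2 * K / 2 ^+ n.+1.
  by rewrite exprS; field; rewrite expf_neq0 ?pnatr_eq0.
have [|n|x Hx] := @nested_point R w (4 * K).
- by rewrite mulr_ge0.
- have := H n; rewrite ler_norml /w => /andP[h1 h2].
  have E1 : 2 * K / 2 ^+ n = 2 * (K / 2 ^+ n) by rewrite mulrA.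
  have E2 : 4 * K / 2 ^+ n.+1 = 2 * (2 * K / 2 ^+ n.+1) by rewrite !mulrA -natrM.
  by rewrite E1 E2 -half in h1 h2 *; apply/andP; split; lra.
exists x => n; have /andP[h1 h2] := Hx n; rewrite /w in h1 h2.
have E2 : 4 * K / 2 ^+ n = 2 * (2 * K / 2 ^+ n) by rewrite !mulrA -natrM.
by rewrite E2 in h2; rewrite ler_norml; apply/andP; split; lra.
Qed.

Lemma geometric_limit (u : nat -> R[i]) (K : R) (j : nat) : 0 <= K ->
  (forall n, (j <= n)%N -> cmod (u n.+1 - u n) <= K / 2 ^+ n) ->
  exists l, forall n, (j <= n)%N -> cmod (u n - l) <= 4 * K / 2 ^+ n.
Proof.
move=> K0 H.
have K0' : 0 <= K / 2 ^+ j by rewrite divr_ge0 // exprn_ge0.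
have E n : K / 2 ^+ j / 2 ^+ n = K / 2 ^+ (j + n) by rewrite exprD invfM mulrA.
have [|a Ha] := @geometric_limit_real (fun n => complex.Re (u (j + n)%N)) _ K0'.
  by move=> n; rewrite E -re_sub (le_trans (cmod_Re _)) // addnS; apply: H; exact: leq_addr.
have [|b Hb] := @geometric_limit_real (fun n => complex.Im (u (j + n)%N)) _ K0'.
  by move=> n; rewrite E -im_sub (le_trans (cmod_Im _)) // addnS; apply: H; exact: leq_addr.
exists (a +i* b) => n jn; rewrite (le_trans (cmod_le _)) // re_sub im_sub /=.
have E' m : 2 * (K / 2 ^+ j) / 2 ^+ m = 2 * (K / 2 ^+ (j + m)) by rewrite -mulrA E.
have := Ha (n - j)%N; have := Hb (n - j)%N; rewrite !E' subnKC //.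
rewrite (_ : 4 * K / 2 ^+ n = 4 * (K / 2 ^+ n)); last by rewrite mulrA.
by move: (K / 2 ^+ n) => t; lra.
Qed.

End GeometricLimit.

Section Cones.
Context {R : realType}.
Variables (gamma : R).
Hypothesis gamma0 : 0 < gamma.

Let H : R := gamma * pi / 2.

Let H0 : 0 < H. Proof. by rewrite divr_gt0 // mulr_gt0 // pi_gt0. Qed.

(** The exhausting subsectors: openings increase to that of the sector and radii to infinity.
    Already [cone 0] has radius 2, so it contains the point 1. *)
Definition cone (j : nat) : set (R * R) :=
  bounded_sector 0 (gamma * (j.+1%:R / j.+2%:R)) j.+2%:R.

Lemma coneP j z : cone j z <->
  [/\ 0 < z.1, `|z.2| < (gamma * pi / 2) * (j.+1%:R / j.+2%:R) & z.1 < j.+2%:R].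
Proof.
rewrite /cone /bounded_sector /= subr0 (_ : gamma * _ * pi / 2 =
  gamma * pi / 2 * (j.+1%:R / j.+2%:R)) //; ring.
Qed.

Lemma cone_angle j : H * (j.+1%:R / j.+2%:R) < H.
Proof. by rewrite gtr_pMr // ltr_pdivrMr // mul1r ltr_nat. Qed.

Lemma bounded_sector_cone (h rho : R) : h < gamma * pi / 2 ->
  exists j, forall z : R * R, 0 < z.1 < rho -> `|z.2| < h -> cone j z.
Proof.
(* The condition [h * (j + 2) <= H * (j + 1)] amounts to [2 * h - H <= j * (H - h)], and the left
   side is below [H]. *)
move=> hH; pose j := Num.bound (Num.max rho (H / (H - h))).
have jP : Num.max rho (H / (H - h)) < j%:R.
  by rewrite archi_boundP // le_max divr_ge0 ?orbT // ?subr_ge0 ltW.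
move: jP; rewrite gt_max => /andP[j1 j2]; exists j => z /andP[z0 zr] zh.
apply/coneP; split => //.
  apply: (lt_le_trans zh); rewrite mulrA ler_pdivlMr //.
  move: j2; rewrite ltr_pdivrMr ?subr_gt0 // => j2.
  rewrite -/H -[j.+2]addn2 -[j.+1]addn1 !natrD.
  move: (j%:R : R) j2 (ler0n R j) (hH : h < H) => t j2 t0; clear -j2 t0.
  by move: H j2 => H' j2 hH'; nra.
by rewrite (lt_trans zr) // (lt_trans j1) // ltr_nat ltnW.
Qed.

Lemma proper_cone j : proper_subsector (cone j) gamma.
Proof.
exists 0, (gamma * (j.+1%:R / j.+2%:R)), j.+2%:R; split => //.
  by rewrite mulr_gt0 // divr_gt0.
move=> z [zc z0]; split => //; rewrite -/H; apply: le_lt_trans (cone_angle j).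
apply/ler_addgt0Pr => e e0; have [z' [/coneP[_ h _] [_ /= h2]]] := zc _ (nbhsx_ballx z _ e0).
rewrite -[z.2](subrK z'.2) (le_trans (ler_normD _ _)) // addrC lerD //.
  exact: ltW.
exact: ltW h2.
Qed.

(** The closure of [T] contains a point of each bounding ray. Both lie in the open sector, so
    [|d| + a] is strictly below its half opening and some cone absorbs [T]. *)
Lemma proper_subsector_cone T : proper_subsector T gamma -> exists j, T `<=` cone j.
Proof.
move=> [d [al [r [al0 r0 TE Tsub]]]].
pose a := al * pi / 2; have a0 : 0 < a by rewrite divr_gt0 // mulr_gt0 // pi_gt0.
have cl s : `|s| = 1 -> sector gamma (r / 2, d + s * a).
  move=> s1; apply: Tsub; split; last by rewrite /Rlog /= divr_gt0.
  move=> B /nbhs_ballP[e /= e0 He].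
  pose t := Num.min (e / 2) (a / 2).
  have e2 : 0 < e / 2 < e by apply/andP; split; lra.
  have a2 : 0 < a / 2 < a by apply/andP; split; lra.
  have [e21 e22] := andP e2; have [a21 a22] := andP a2.
  have t0 : 0 < t by rewrite lt_min e21.
  have te : t < e by rewrite gt_min e22.
  have ta : t < a by rewrite gt_min a22 orbT.
  exists (r / 2, d + s * (a - t)); split.
    rewrite TE; split => /=; first by rewrite /Rlog /= divr_gt0.
      rewrite addrAC subrr add0r normrM s1 mul1r -/a ger0_norm; first by lra.
      by rewrite subr_ge0 ltW.
    by lra.
  apply: He; split; rewrite /ball /=; first by rewrite subrr normr0.
  have -> : d + s * a - (d + s * (a - t)) = s * t by ring.
  by rewrite normrM s1 mul1r gtr0_norm.
have [_ /= h1] := cl 1 (normr1 _).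
have [_ /= h2] : sector gamma (r / 2, d + (-1) * a) by apply: cl; rewrite normrN1.
have hd : `|d| + a < gamma * pi / 2.
  move: h1 h2; rewrite !ltr_norml -/H => /andP[? ?] /andP[? ?].
  by have [d0|d0] := leP 0 d; [rewrite ger0_norm //|rewrite ltr0_norm //]; lra.
have [j Hj] := @bounded_sector_cone (`|d| + a) r hd; exists j => z.
rewrite TE => -[z0 zd zr]; apply: Hj; first by rewrite zr andbT.
rewrite -[z.2](subrK d) (le_lt_trans (ler_normD _ _)) // addrC ltrD2l.
exact: zd.
Qed.

Lemma cone_sector j : cone j `<=` sector gamma.
Proof. by move=> z /coneP[z0 h _]; split => //; exact: lt_trans (cone_angle j). Qed.

End Cones.

(** * Remainders of asymptotic expansions *)


Section Expansions.
Context {R : realType}.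
Variables (M : nat -> R) (gamma : R).
Hypothesis Mgt0 : forall p, 0 < M p.
Hypothesis gamma0 : 0 < gamma.
Local Notation C := (R[i]^o).
Implicit Types (f g : R * R -> C) (b : nat -> R) (T : set (R * R)).

(** Bounded real [b] parametrise series of the class with geometric rate 1; the unit ball of these
    [b] is the space to which Baire's theorem applies. *)
Definition weighted b : nat -> C := fun i => (M i * b i)%:C.

Definition remainder f b (p : nat) (z : R * R) : R[i] :=
  f z - \sum_(i < p) (M i * b i)%:C * Rlog_proj z ^+ i.

Definition remainder_bound T f b (K A : R) : Prop := forall z p, T z ->
  cmod (remainder f b p z) <= K * A ^+ p * M p * z.1 ^+ p.

Lemma expansion_onP T f b : expansion_on M T f (weighted b) <->
  exists K A, [/\ 0 < K, 0 < A & remainder_bound T f b K A].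
Proof.
split=> -[K [A [K0 A0 H]]]; exists K, A; split => // z p Tz.
  by rewrite -lec_cmod; exact: H.
by rewrite lec_cmod; exact: H.
Qed.

Lemma remainder_lin f g b b' (s t : R) p z :
  remainder (fun z => s%:C * f z + t%:C * g z) (fun i => s * b i + t * b' i) p z =
  s%:C * remainder f b p z + t%:C * remainder g b' p z.
Proof.
rewrite /remainder !mulrBr !mulr_sumr addrACA -opprD -big_split /=; congr (_ - _).
by apply: eq_bigr => i _; rewrite mulrDr !rmorphD !rmorphM /=; ring.
Qed.

Lemma remainder_bound_lin T f g b b' (s t K K' A : R) :
  remainder_bound T f b K A -> remainder_bound T g b' K' A ->
  remainder_bound T (fun z => s%:C * f z + t%:C * g z)
    (fun i => s * b i + t * b' i) (`|s| * K + `|t| * K') A.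
Proof.
move=> H H' z p Tz; rewrite remainder_lin (le_trans (cmodD _ _)) // !cmodM !cmod_real.
rewrite -!mulrA mulrDl !mulrA lerD // -!mulrA ler_wpM2l //.
  by rewrite !mulrA; exact: H.
by rewrite !mulrA; exact: H'.
Qed.

Lemma remainder_bound_weaken T f b (K K' A A' : R) : (forall z, T z -> 0 < z.1) ->
  0 <= K -> K <= K' -> 0 < A -> A <= A' ->
  remainder_bound T f b K A -> remainder_bound T f b K' A'.
Proof.
move=> T0 K0 KK A0 AA H z p Tz; apply: (le_trans (H z p Tz)).
rewrite ler_wpM2r ?exprn_ge0 ?(ltW (T0 _ Tz)) // ler_wpM2r ?(ltW (Mgt0 p)) //.
apply: ler_pM => //; first by rewrite exprn_ge0 // ltW.
by rewrite lerXn2r // nnegrE ltW // (lt_le_trans A0).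
Qed.

Lemma is_derivative_lin f g (z : R * R) (s t : R) (l m : C) :
  is_derivative f z l -> is_derivative g z m ->
  is_derivative (fun z => s%:C * f z + t%:C * g z) z (s%:C * l + t%:C * m).
Proof.
move=> fd gd.
have cc c := @cvg_cst R[i]^o (c : R[i]^o) _ (dnbhs z) (dnbhs_filter z).
have H := cvgD (cvgM (cc s%:C) fd) (cvgM (cc t%:C) gd).
rewrite /is_derivative.
have -> : (fun w : R * R => ((s%:C * f w + t%:C * g w - (s%:C * f z + t%:C * g z)) /
    (Rlog_proj w - Rlog_proj z) : C)) =
  (fun w => (s%:C : C) * ((f w - f z) / (Rlog_proj w - Rlog_proj z) : C) +
     (t%:C : C) * ((g w - g z) / (Rlog_proj w - Rlog_proj z) : C)).
  apply/funext => w; set q := (Rlog_proj w - _)^-1.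
  by move: (f w) (f z) (g w) (g z) => a b c d; ring.
exact: H.
Qed.

Definition admissible f b : Prop := holomorphic_on (sector gamma) f /\
  asymptotic_expansion M gamma f (weighted b).

Lemma admissible_bound f b T : proper_subsector T gamma -> admissible f b ->
  exists K A, [/\ 0 < K, 0 < A & remainder_bound T f b K A].
Proof. by move=> pT [_ /(_ T pT)/expansion_onP]. Qed.

Lemma proper_subsector_gt0 T : proper_subsector T gamma -> forall z, T z -> 0 < z.1.
Proof. by move=> [d [al [r [_ _ -> _]]]] z []. Qed.

Lemma holomorphic_lin f g (s t : R) :
  holomorphic_on (sector gamma) f -> holomorphic_on (sector gamma) g ->
  holomorphic_on (sector gamma) (fun z => s%:C * f z + t%:C * g z).
Proof.
move=> fh gh z zS; have [l hl] := fh z zS; have [m hm] := gh z zS.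
by exists (s%:C * l + t%:C * m); exact: is_derivative_lin.
Qed.

Lemma admissible_lin f g b b' (s t : R) : admissible f b -> admissible g b' ->
  admissible (fun z => s%:C * f z + t%:C * g z) (fun i => s * b i + t * b' i).
Proof.
move=> fa ga; split; first by case: fa => ? _; case: ga => ? _; exact: holomorphic_lin.
move=> T pT; apply/expansion_onP; have T0 := proper_subsector_gt0 pT.
have [K [A [K0 A0 H]]] := admissible_bound pT fa.
have [K' [A' [K'0 A'0 H']]] := admissible_bound pT ga.
exists (`|s| * K + `|t| * K' + 1), (A + A'); split; [|exact: addr_gt0|].
  by rewrite ltr_wpDl // addr_ge0 // mulr_ge0 // ltW.
apply: (@remainder_bound_weaken _ _ _ (`|s| * K + `|t| * K') _ (A + A')) => //.
- by rewrite addr_ge0 // mulr_ge0 // ltW.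
- by rewrite lerDl.
- exact: addr_gt0.
apply: remainder_bound_lin.
  by apply: remainder_bound_weaken H => //; rewrite ?(ltW K0) // lerDl ltW.
by apply: remainder_bound_weaken H' => //; rewrite ?(ltW K'0) // lerDr ltW.
Qed.

Lemma remainder_sum (F : nat -> R * R -> C) (E : nat -> nat -> R) N p z :
  remainder (fun z => \sum_(k < N) F k z) (fun i => \sum_(k < N) E k i) p z =
  \sum_(k < N) remainder (F k) (E k) p z.
Proof.
rewrite /remainder sumrB; congr (_ - _); rewrite exchange_big /=.
apply: eq_bigr => i _; rewrite mulr_sumr rmorph_sum mulr_suml.
by apply: eq_bigr.
Qed.

Lemma holomorphic_sum (F : nat -> R * R -> C) N :
  (forall k, holomorphic_on (sector gamma) (F k)) ->
  holomorphic_on (sector gamma) (fun z => \sum_(k < N) F k z).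
Proof.
move=> Fh; elim: N => [|N IH].
  have -> : (fun z => \sum_(k < 0) F k z) = (fun z => 0%:C * F 0%N z + 0%:C * F 0%N z).
    by apply/funext => w; rewrite big_ord0 !mul0r addr0.
  exact: holomorphic_lin.
have -> : (fun z => \sum_(k < N.+1) F k z) =
    (fun z => 1%:C * (\sum_(k < N) F k z) + 1%:C * F N z).
  by apply/funext => w; rewrite big_ord_recr /= !mul1r.
exact: holomorphic_lin.
Qed.

Lemma cmod_Rlog_proj (z : R * R) : 0 <= z.1 -> cmod (Rlog_proj z) = z.1.
Proof.
move=> z0; rewrite /cmod /Rlog_proj /= !exprMn -mulrDr cos2Dsin2 mulr1 sqrtr_sqr.
by rewrite ger0_norm.
Qed.

(** On the cone [j] the summands of index at least [j] share the rate [(nu j).+1] and have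
    geometrically small constants. The earlier ones are finitely many, so their constants and rates
    can be added in. *)
Lemma expansion_series (F : nat -> R * R -> C) (E : nat -> nat -> R) g b
    (nu : nat -> nat) :
  (forall k, admissible (F k) (E k)) ->
  (forall j k, (j <= k)%N -> remainder_bound (cone gamma j) (F k) (E k)
     (2 / 2 ^+ k * (nu j).+1%:R) (nu j).+1%:R) ->
  (forall N p, `|\sum_(k < N) E k p - b p| <= 1 / 2 ^+ N) ->
  (forall z j, cone gamma j z -> forall N, (j <= N)%N ->
     cmod (\sum_(k < N) F k z - g z) <= 4 * (2 * M 0%N * (nu j).+1%:R) / 2 ^+ N) ->
  asymptotic_expansion M gamma g (weighted b).
Proof.
move=> Fa FB EB gB T pT; apply/expansion_onP.
have [j Tj] := proper_subsector_cone gamma0 pT.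
have pj := proper_cone gamma0 j; have T0 := proper_subsector_gt0 pj.
pose n : R := (nu j).+1%:R; have n0 : 0 < n by rewrite ltr0n.
have fin m : exists K A, [/\ 0 < K, n <= A & forall k, (k < m)%N ->
    remainder_bound (cone gamma j) (F k) (E k) K A].
  elim: m => [|m [K [A [K0 nA H]]]]; first by exists 1, n; split.
  have [K' [A' [K'0 A'0 H']]] := admissible_bound pj (Fa m).
  exists (K + K'), (A + A'); split; first exact: addr_gt0.
    by rewrite (le_trans nA) // lerDl ltW.
  have A0 := lt_le_trans n0 nA.
  move=> k; rewrite ltnS leq_eqVlt => /predU1P[->|/H {}H].
    by apply: remainder_bound_weaken H' => //; rewrite ?(ltW K'0) // lerDr ltW.
  by apply: remainder_bound_weaken H => //; rewrite ?(ltW K0) // lerDl ltW.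
have [K [A [K0 nA H]]] := fin j; have A0 := lt_le_trans n0 nA.
exists (j%:R * K + 4 * n), A; split => //.
  by rewrite ltr_wpDl ?mulr_gt0 // mulr_ge0 // ltW.
move=> z p /Tj zj; have z0 := T0 z zj.
set Q := A ^+ p * M p * z.1 ^+ p.
have Q0 : 0 < Q by rewrite !mulr_gt0 // exprn_gt0.
(* The early summands contribute at most [j * K], the later ones [2 * n / 2^k] each. Bounding
   [2^-(j + m)] by [2^-m] makes the sum telescope below [4 * n]. *)
have tail m : \sum_(k < j + m) cmod (remainder (F k) (E k) p z) <=
    (j%:R * K + 4 * n - 4 * n / 2 ^+ m) * Q.
  elim: m => [|m IH].
    rewrite addn0 expr0 divr1 addrK -mulrA mulr_natl -[in leRHS](card_ord j) -sumr_const.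
    apply: ler_sum => k _; rewrite /Q !mulrA; exact: H.
  rewrite addnS big_ord_recr /=.
  have := FB j (j + m)%N (leq_addr _ _) z p zj; rewrite -/n => Fk.
  have le2 : 2 / 2 ^+ (j + m) * n * Q <= (4 * n / 2 ^+ m - 4 * n / 2 ^+ m.+1) * Q.
    rewrite ler_wpM2r ?(ltW Q0) // exprS.
    have -> : 4 * n / 2 ^+ m - 4 * n / (2 * 2 ^+ m) = 2 / 2 ^+ m * n.
      by field; rewrite expf_neq0 // pnatr_eq0.
    rewrite ler_wpM2r ?(ltW n0) // ler_wpM2l // lef_pV2 ?posrE ?exprn_gt0 //.
    by rewrite exprD ler_peMl ?exprn_ge0 // exprn_ege1 // ler1n.
  have le3 : 2 / 2 ^+ (j + m) * n * n ^+ p * M p * z.1 ^+ p <= 2 / 2 ^+ (j + m) * n * Q.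
    rewrite /Q -!mulrA; do 3 (rewrite ler_wpM2l ?(ltW n0) ?invr_ge0 ?exprn_ge0 //).
    rewrite ler_wpM2r ?mulr_ge0 ?exprn_ge0 ?(ltW (Mgt0 p)) ?(ltW z0) //.
    by rewrite lerXn2r // nnegrE ltW.
  move: le2 le3 Fk IH; rewrite !mulrBl.
  by move: (4 * n / 2 ^+ m * Q) (4 * n / 2 ^+ m.+1 * Q) => *; lra.
apply/ler_addgt0Pr => e e0.
(* For fixed [z] and [p], [D / 2^N] bounds what is lost by replacing [g] and [b] by their N-th
   partial sums. Letting [N] grow leaves the bound of [tail], which is independent of [N]. *)
pose D := 4 * (2 * M 0%N * n) + \sum_(i < p) M i * z.1 ^+ i.
have D0 : 0 <= D.
  rewrite addr_ge0 ?mulr_ge0 ?(ltW n0) ?(ltW (Mgt0 _)) // sumr_ge0 // => i _.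
  by rewrite mulr_ge0 ?exprn_ge0 ?(ltW (Mgt0 _)) ?(ltW z0).
have [m De] := exists_div_exp2_lt D e0.
have De' : D / 2 ^+ (j + m) <= e.
  apply: le_trans (ltW De); rewrite ler_wpM2l // lef_pV2 ?posrE ?exprn_gt0 //.
  by rewrite exprD ler_peMl ?exprn_ge0 // exprn_ege1 // ler1n.
pose N := (j + m)%N.
have -> : remainder g b p z = \sum_(k < N) remainder (F k) (E k) p z
    - (\sum_(k < N) F k z - g z)
    + \sum_(i < p) (M i * (\sum_(k < N) E k i - b i))%:C * Rlog_proj z ^+ i.
  rewrite -remainder_sum /remainder.
  have -> : \sum_(i < p) (M i * (\sum_(k < N) E k i - b i))%:C * Rlog_proj z ^+ i =
    \sum_(i < p) (M i * (\sum_(k < N) E k i))%:C * Rlog_proj z ^+ i -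
    \sum_(i < p) (M i * b i)%:C * Rlog_proj z ^+ i.
    by rewrite -sumrB; apply: eq_bigr => i _; rewrite mulrBr rmorphB mulrBl.
  move: (\sum_(k < N) F k z) (\sum_(i < p) _) (\sum_(i < p) _) (g z) => *; ring.
rewrite (le_trans (cmodD _ _)) //.
have h1 : cmod (\sum_(k < N) remainder (F k) (E k) p z - (\sum_(k < N) F k z - g z)) <=
    (j%:R * K + 4 * n) * Q + 4 * (2 * M 0%N * n) / 2 ^+ N.
  rewrite (le_trans (cmodB _ _)) // lerD //; last exact: gB zj N (leq_addr _ _).
  rewrite (le_trans (cmod_sum _ (fun k => remainder (F k) (E k) p z))) //.
  rewrite (le_trans (tail m)) // ler_wpM2r ?(ltW Q0) // gerBl.
  by rewrite mulr_ge0 ?invr_ge0 ?exprn_ge0 // mulr_ge0 // ltW.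
have h2 : cmod (\sum_(i < p) (M i * (\sum_(k < N) E k i - b i))%:C * Rlog_proj z ^+ i) <=
    (\sum_(i < p) M i * z.1 ^+ i) / 2 ^+ N.
  rewrite (le_trans (cmod_sum _ (fun i => (M i * (\sum_(k < N) E k i - b i))%:C * Rlog_proj z ^+ i))) //.
  rewrite mulr_suml; apply: ler_sum => i _.
  rewrite cmodM cmod_real cmodX cmod_Rlog_proj ?(ltW z0) // normrM gtr0_norm //.
  rewrite -!mulrA ler_wpM2l ?(ltW (Mgt0 _)) // mulrC ler_wpM2l ?exprn_ge0 ?(ltW z0) //.
  by have := EB N i; rewrite mul1r.
apply: (le_trans (lerD h1 h2)).
rewrite -addrA -mulrDl -/D [X in X + _ <= _](_ : _ = (j%:R * K + 4 * n) * A ^+ p * M p * z.1 ^+ p).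
  by rewrite lerD2l.
by rewrite /Q !mulrA.
Qed.

End Expansions.

(** * The closed graph argument *)


Section ClosedGraph.
Context {R : realType}.
Variables (M : nat -> R) (gamma : R).
Hypothesis M0 : M 0%N = 1.
Hypothesis Mgt0 : forall p, 0 < M p.
Hypothesis gamma0 : 0 < gamma.
Local Notation C := (R[i]^o).
Local Notation admissible := (admissible M gamma).
Local Notation bound := (remainder_bound M).

Hypothesis solvable : forall b : nat -> R, (forall p, `|b p| <= 1) ->
  exists f : R * R -> C, admissible f b.

(** One integer per cone serves as both constants of the bound, so only countably many choices occur
    at each level. *)
Definition tame (s : seq nat) (b : nat -> R) : Prop := (forall p, `|b p| <= 1) /\
  exists2 f : R * R -> C, admissible f b & forall j, (j < size s)%N ->
    bound (cone gamma j) f b (nth 0%N s j).+1%:R (nth 0%N s j).+1%:R.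

(** [tame s] is the union over [n] of [tame (rcons s n)]: the same function [f] obeys some integer
    constant on the next cone. *)
Lemma tame_nonmeager_rcons s : ~ meager (tame s) ->
  exists n, ~ meager (tame (rcons s n)).
Proof.
move=> sm; apply: contrapT => H; apply: sm.
apply: (@meager_bigcup _ _ (fun n => tame (rcons s n))).
  by move=> n; apply: contrapT => Hn; apply: H; exists n.
move=> b [b1 [f fa fb]].
have pj := proper_cone gamma0 (size s).
have [K [A [K0 A0 H']]] := admissible_bound pj fa.
pose n := Num.bound (Num.max K A); exists n => //; split => //.
exists f => // j; rewrite size_rcons ltnS leq_eqVlt nth_rcons => /predU1P[->|js].
  have : Num.max K A < n%:R by rewrite archi_boundP // le_max ltW.
  rewrite gt_max => /andP[Kn An]; rewrite ltnn eqxx.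
  apply: remainder_bound_weaken H' => //; rewrite ?(ltW K0) //.
  - exact: proper_subsector_gt0 pj.
  - by rewrite (le_trans (ltW Kn)) // ler_nat.
  - by rewrite (le_trans (ltW An)) // ler_nat.
by rewrite js; exact: fb.
Qed.

Lemma tame_nonmeager : exists nu : nat -> nat, forall k, ~ meager (tame (mkseq nu k)).
Proof.
have : forall s, exists n, ~ meager (tame s) -> ~ meager (tame (rcons s n)).
  move=> s; have [H|H] := pselect (meager (tame s)); first by exists 0%N.
  by have [n Hn] := tame_nonmeager_rcons H; exists n.
move=> /choice[nxt nxtP].
pose s := fix s k := if k is m.+1 then rcons (s m) (nxt (s m)) else [::].
exists (fun k => nxt (s k)) => k.
have -> : mkseq (fun k => nxt (s k)) k = s k.
  by elim: k => [|k IH] //; rewrite mkseqS IH.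
elim: k => [|k IH] /=; last exact: nxtP.
(* With no cone constrained, [solvable] makes every point of the unit box tame. *)
move=> Em; apply: (@unit_box_nonmeager R).
case: Em => F [Fnd FE]; exists F; split => // x x1; apply: FE; split => //.
by have [f fa] := solvable x1; exists f.
Qed.

(** Scaling acts on the first constant only; the geometric rate [(nu j).+1] stays fixed, which lets
    the bounds be summed. *)
Definition tame_multiple (nu : nat -> nat) k (s : R) (b : nat -> R) : Prop :=
  exists2 f : R * R -> C, admissible f b & forall j, (j < k)%N ->
    bound (cone gamma j) f b (s * (nu j).+1%:R) (nu j).+1%:R.

(** The ball where tame sequences are dense has an unknown centre [c]. Differences of tame sequences
    close to [c + x / s] and to [c] recentre it at 0, at the price of the factor 2. *)
Lemma tame_dense : exists (nu : nat -> nat) (r : nat -> R), (forall k, 0 < r k) /\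
  forall k s x e, 0 < s -> 0 < e -> (forall p, `|x p| <= s * r k) ->
    exists2 y, tame_multiple nu k (2 * s) y & forall p, `|x p - y p| <= e.
Proof.
have [nu nuP] := tame_nonmeager; exists nu.
suff : forall k, exists r, 0 < r /\ forall s x e, 0 < s -> 0 < e ->
    (forall p, `|x p| <= s * r) ->
    exists2 y, tame_multiple nu k (2 * s) y & forall p, `|x p - y p| <= e.
  by move=> /choice[r rP]; exists r; split => k; have [] := rP k.
move=> k; have [c [r [r0 H]]] := nonmeager_somewhere_dense (nuP k).
exists (r / 2); split=> [|s x e s0 e0 xs]; first by rewrite divr_gt0.
(* [d <= r / 2] keeps the ball about [c + x / s] inside the given one; the two errors, scaled by
   [s], add up to [2 * s * d <= e]. *)
pose d := Num.min (r / 2) (e / (2 * s)).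
have d0 : 0 < d by rewrite lt_min !divr_gt0 // mulr_gt0.
have dr : d <= r / 2 by rewrite ge_min lexx.
have de : d <= e / (2 * s) by rewrite ge_min lexx orbT.
have [||y1 [_ [f1 f1a f1b]] y1P] := H (fun p => c p + s^-1 * x p) d => //.
  move=> p; rewrite addrAC subrr add0r normrM gtr0_norm ?invr_gt0 //.
  have : s^-1 * `|x p| <= r / 2 by rewrite ler_pdivrMl.
  by lra.
have [||y2 [_ [f2 f2a f2b]] y2P] := H c d => //.
  by move=> p; rewrite subrr normr0 add0r; lra.
exists (fun p => s * y1 p + (- s) * y2 p).
  exists (fun z => s%:C * f1 z + (- s)%:C * f2 z).
    exact: admissible_lin.
  move=> j jk; have jk' : (j < size (mkseq nu k))%N by rewrite size_mkseq.
  have := remainder_bound_lin s (- s) (f1b j jk') (f2b j jk').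
  rewrite nth_mkseq // normrN gtr0_norm // -mulrDl.
  by have -> : s + s = 2 * s by ring.
move=> p; have := y1P p; have := y2P p; set a := y2 p - c p; set b := y1 p - _.
move=> ha hb; have -> : x p - (s * y1 p + - s * y2 p) = s * (a - b).
  by rewrite /a /b; field; exact: lt0r_neq0.
rewrite normrM gtr0_norm // mulrC -ler_pdivlMr //.
apply: (le_trans (ler_normB _ _)); apply: (le_trans (lerD ha hb)).
apply: (le_trans (lerD de de)).
by rewrite le_eqVlt; apply/orP; left; apply/eqP; field; exact: lt0r_neq0.
Qed.

Lemma closed_graph : exists (B r : R), 0 < r /\
  forall b : nat -> R, (forall p, `|b p| <= r) -> exists2 f : R * R -> C,
    admissible f b & forall z, cone gamma 0 z -> cmod (f z) <= B.
Proof.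
have [nu [r [r0 dense]]] := tame_dense.
(* The first number bounds the distance from the limit to the empty partial sum on [cone 0]. The
   second makes [b] satisfy at stage 0 both bounds required of residuals. *)
exists (4 * (2 * M 0%N * (nu 0%N).+1%:R)), (Num.min 1 (r 1%N)); split=> [|b br].
  by rewrite lt_min ltr01 r0.
pose s k : R := 1 / 2 ^+ k.
have s0 k : 0 < s k by rewrite divr_gt0 // exprn_gt0.
(* The residual must be below [s k.+1 * r k.+2] to be approximated again with one more cone, and
   below [s k.+1] to tend to 0. *)
pose e k := Num.min (s k.+1) (s k.+1 * r k.+2).
have e0 k : 0 < e k by rewrite lt_min s0 mulr_gt0.
have step : forall kx : nat * (nat -> R), exists y : nat -> R,
    (forall p, `|kx.2 p| <= s kx.1 * r kx.1.+1) ->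
    tame_multiple nu kx.1.+1 (2 * s kx.1) y /\ forall p, `|kx.2 p - y p| <= e kx.1.
  move=> [k x] /=; have [H|H] := pselect (forall p, `|x p| <= s k * r k.+1).
    by have [y y1 y2] := dense k.+1 (s k) x (e k) (s0 k) (e0 k) H; exists y.
  by exists x.
have [nxt nxtP] := choice step.
pose X := fix X k := if k is m.+1 then (fun p => X m p - nxt (m, X m) p) else b.
pose E k := nxt (k, X k).
have Xb k : forall p, `|X k p| <= s k * r k.+1.
  elim: k => [|k IH] p; first by rewrite /s expr0 divr1 mul1r (le_trans (br p)) // ge_min lexx orbT.
  have [_ /(_ p) h] := nxtP (k, X k) IH.
  by rewrite /= (le_trans h) // /e /= ge_min lexx orbT.
have Xs k p : `|X k p| <= s k.
  case: k => [|k]; first by rewrite /s expr0 divr1 (le_trans (br p)) // ge_min lexx.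
  have [_ /(_ p) h] := nxtP (k, X k) (Xb k).
  by rewrite /= (le_trans h) // /e /= ge_min lexx.
have /choice[F FP] : forall k, exists f : R * R -> C, admissible f (E k) /\
    forall j, (j < k.+1)%N -> bound (cone gamma j) f (E k)
      (2 * s k * (nu j).+1%:R) (nu j).+1%:R.
  by move=> k; have [[f fa fb] _] := nxtP (k, X k) (Xb k); exists f.
have Fa k : admissible (F k) (E k) by have [] := FP k.
have FB j k : (j <= k)%N -> bound (cone gamma j) (F k) (E k)
    (2 / 2 ^+ k * (nu j).+1%:R) (nu j).+1%:R.
  by move=> jk; have [_ /(_ j jk)] := FP k; rewrite /s mulrA mulr1.
have sumE N p : \sum_(k < N) E k p = b p - X N p.
  elim: N => [|N IH]; first by rewrite big_ord0 subrr.
  by rewrite big_ord_recr IH /= /E; ring.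
have EB N p : `|\sum_(k < N) E k p - b p| <= 1 / 2 ^+ N.
  by rewrite sumE addrAC subrr add0r normrN; exact: Xs.
(* The remainder of order 0 is the function itself, so its bound makes the partial sums converge
   geometrically from index [j] on. *)
have lim j z : cone gamma j z -> exists l, forall N, (j <= N)%N ->
    cmod (\sum_(k < N) F k z - l) <= 4 * (2 * M 0%N * (nu j).+1%:R) / 2 ^+ N.
  move=> zj; apply: geometric_limit; first by rewrite !mulr_ge0 // ltW.
  move=> N jN; rewrite big_ord_recr /= addrAC subrr add0r.
  have := FB j N jN z 0%N zj; rewrite /remainder big_ord0 subr0 !expr0 !mulr1.
  by rewrite M0 mulr1 !mulr1 mulrAC.
(* The limit at [z] must not depend on the cone used: two candidates are both approached by the same
   partial sums. Points outside all cones get the value 0. *)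
have : forall z, exists l, forall j, cone gamma j z -> forall N, (j <= N)%N ->
    cmod (\sum_(k < N) F k z - l) <= 4 * (2 * M 0%N * (nu j).+1%:R) / 2 ^+ N.
  move=> z; have [[j0 zj0]|none] := pselect (exists j, cone gamma j z); last first.
    by exists 0 => j zj; case: none; exists j.
  have [l Hl] := lim j0 z zj0; exists l => j zj N jN.
  have [l' Hl'] := lim j z zj; suff -> : l = l' by exact: Hl'.
  apply/eqP; rewrite -subr_eq0; apply/eqP.
  pose K := 4 * (2 * M 0%N * (nu j0).+1%:R) + 4 * (2 * M 0%N * (nu j).+1%:R).
  apply: (@cmod_small_eq0 _ _ 1 1) => // t t0 _; rewrite mul1r.
  have [m /ltW Km] := exists_div_exp2_lt K t0.
  have := Hl (m + (j0 + j))%N; rewrite addnCA leq_addr => /(_ isT) h1.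
  have := Hl' (j0 + (m + j))%N; rewrite addnA leq_addl => /(_ isT) h2.
  have e1 : (j0 + (m + j))%N = (j0 + m + j)%N by rewrite addnA.
  rewrite e1 cmodBC in h1.
  apply: (le_trans (cmod_trans _ (\sum_(k < j0 + m + j) F k z) _)).
  apply: (le_trans (lerD h1 h2)); rewrite -mulrDl -/K; apply: le_trans Km.
  have K0 : 0 <= K by rewrite addr_ge0 // !mulr_ge0 // ltW.
  rewrite ler_wpM2l // lef_pV2 ?posrE ?exprn_gt0 //.
  by rewrite ler_eXn2l ?ltr1n // addnAC leq_addl.
move=> /choice[g gP].
exists g; last first.
  move=> z z0; have := gP z 0%N z0 0%N (leqnn _).
  by rewrite big_ord0 sub0r cmodN expr0 divr1.
split; last by apply: (expansion_series Mgt0 gamma0 Fa FB EB) => z j; exact: gP.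
apply: (@sector_weierstrass _ _ (fun N z => \sum_(k < N) F k z)).
  by move=> N; apply: holomorphic_sum => k; have [[]] := FP k.
move=> rho theta thg; have [j Hj] := bounded_sector_cone gamma0 rho thg.
pose K := 4 * (2 * M 0%N * (nu j).+1%:R).
have K0 : 0 <= K by rewrite !mulr_ge0 // ltW.
split=> [t t0|].
  have [m /ltW Km] := exists_div_exp2_lt K t0; exists (j + m)%N => z zr zt.
  apply: (le_trans (gP z j (Hj z zr zt) (j + m)%N (leq_addr _ _))).
  apply: le_trans Km; rewrite ler_wpM2l // lef_pV2 ?posrE ?exprn_gt0 //.
  by rewrite ler_eXn2l ?ltr1n // leq_addl.
(* The first [j] summands escape the common constants on this cone, but each is bounded there by its
   own expansion at order 0. *)
have : exists B, forall z, cone gamma j z -> cmod (\sum_(k < j) F k z) <= B.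
  suff : forall m, exists B, forall z, cone gamma j z -> cmod (\sum_(k < m) F k z) <= B by exact.
  elim=> [|m [B HB]]; first by exists 0 => z _; rewrite big_ord0 cmod0.
  have [K' [A [_ _ H]]] := admissible_bound (proper_cone gamma0 j) (Fa m).
  exists (B + K') => z zj; rewrite big_ord_recr /= (le_trans (cmodD _ _)) // lerD //.
    exact: HB.
  have := H z 0%N zj; rewrite /remainder big_ord0 subr0 !expr0 !mulr1.
  by rewrite M0 mulr1.
move=> [B HB]; exists (B + K) => z zr zt; have zj := Hj z zr zt.
rewrite -[g z](subKr (\sum_(k < j) F k z)) (le_trans (cmodB _ _)) // lerD ?HB //.
apply: (le_trans (gP z j zj j (leqnn _))).
by rewrite ler_pdivrMr ?exprn_gt0 // ler_peMr // exprn_ege1 // ler1n.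
Qed.

End ClosedGraph.

(** * The Borel map *)


Section BorelMap.
Context {R : realType}.
Variables (M : nat -> R) (gamma : R).
Hypothesis hM : weight_sequence M.
Hypothesis gamma0 : 0 < gamma.
Local Notation C := (R[i]^o).
Implicit Types (f g : R * R -> C) (a : nat -> C).

Let M0 : M 0%N = 1. Proof. by case: hM. Qed.
Let Mgt0 p : 0 < M p. Proof. by case: hM. Qed.

(** Once the lower coefficients agree, the remainders of order [n + 1] at the point [(t, 0)] differ
    by [(a n - a' n) * t^n], which is [O(t^(n+1))] as [t] tends to 0. *)
Lemma asymptotic_expansion_unique f a a' : asymptotic_expansion M gamma f a ->
  asymptotic_expansion M gamma f a' -> a = a'.
Proof.
move=> fa fa'; have pc := proper_cone gamma0 0.
have [K [A [K0 A0 H]]] := fa _ pc; have [K' [A' [K'0 A'0 H']]] := fa' _ pc.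
apply/funext => n; have [m nm] := ubnP n.
elim: m => // m IH in n nm *.
apply/eqP; rewrite -subr_eq0; apply/eqP.
apply: (@cmod_small_eq0 _ (a n - a' n) (K * A ^+ n.+1 * M n.+1 + K' * A' ^+ n.+1 * M n.+1) 1) => //.
move=> t t0 t1; have zc : cone gamma 0 (t, 0).
  apply/coneP; split => //=; last by rewrite (le_lt_trans t1) // ltr1n.
  by rewrite normr0 !mulr_gt0 // ?pi_gt0 // ?invr_gt0.
have := H _ n.+1 zc; have := H' _ n.+1 zc; rewrite !lec_cmod /= => h' h.
rewrite -(ler_pM2r (exprn_gt0 n t0)) -[leRHS]mulrA -exprS mulrDl.
have -> : cmod (a n - a' n) * t ^+ n =
   cmod ((f (t, 0) - \sum_(i < n.+1) a' i * Rlog_proj (t, 0) ^+ i) -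
         (f (t, 0) - \sum_(i < n.+1) a i * Rlog_proj (t, 0) ^+ i)).
  have PE : cmod (Rlog_proj (t, 0)) = t by rewrite cmod_Rlog_proj // ltW.
  rewrite -[in LHS]PE -cmodX -cmodM; congr cmod; rewrite !big_ord_recr /=.
  have -> : \sum_(i < n) a' i * Rlog_proj (t, 0) ^+ i = \sum_(i < n) a i * Rlog_proj (t, 0) ^+ i.
    by apply: eq_bigr => i _; rewrite (IH i) // (leq_trans (ltn_ord i)).
  by move: (f _) (\sum_(i < n) _) (Rlog_proj _ ^+ n) (a n) (a' n) => *; ring.
by rewrite (le_trans (cmodB _ _)) // addrC lerD.
Qed.

Lemma borel_eq f a : asymptotic_expansion M gamma f a -> borel M gamma f = a.
Proof.
move=> fa; rewrite /borel; case: xgetP => [b -> fb|/(_ a)//].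
exact: asymptotic_expansion_unique fb fa.
Qed.

(** The default of [borel] is 0, so a nonzero value must be an expansion. This supplies the
    expansion even when [f] is taken from an abstract class. *)
Lemma borel_neq0 f a : borel M gamma f = a -> a <> (fun=> 0) ->
  asymptotic_expansion M gamma f a.
Proof. by rewrite /borel; case: xgetP => [b -> fb <-|_ <-]. Qed.

Lemma cdiff_cexp_pow (c : R[i]) (w : R[i]) p :
  exists k, cdiff (fun u => c * cexp u ^+ p) w k.
Proof.
elim: p => [|p [k hk]].
  exists 0 => e e0; exists 1 => // u _.
  by rewrite !expr0 subrr mul0r subrr cmod0 mulr_ge0 ?cmod_ge0 ?ltW.
(* Multiplication by [cexp] is written as division by [1 / cexp], so that [cdiff_div] covers it. *)
have [l hl] : exists l, cdiff (fun u => 1 / cexp u) w l.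
  have c1 : cdiff (fun=> 1 : R[i]) w 0.
    move=> e e0; exists 1 => // u _.
    by rewrite subrr mul0r subrr cmod0 mulr_ge0 ?cmod_ge0 ?ltW.
  exact: cdiff_div c1 (cexp_cdiff w) (cexp_neq0 w).
have [|m hm] := cdiff_div hk hl; first by rewrite mul1r invr_eq0 cexp_neq0.
exists m; apply: cdiff_near ltr01 _ hm => u _.
by rewrite mul1r invrK exprSr mulrA.
Qed.

Lemma admissible_monomial p (r : R) : 0 < r ->
  admissible M gamma (fun z => (M p * r)%:C * Rlog_proj z ^+ p : C)
    (fun i => if i == p then r else 0).
Proof.
move=> r0; split.
  move=> z [z0 _]; have [k hk] := cdiff_cexp_pow (M p * r)%:C (ln z.1 +i* z.2) p.
  exact: is_derivative_log_chart hk.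
move=> T pT; apply/expansion_onP; have T0 := proper_subsector_gt0 pT.
have [d [al [rho [_ rho0 TE _]]]] := pT.
(* For [q <= p] the remainder is the whole monomial, and [z.1^(p - q) <= (rho + 1)^p] because
   [rho + 1 >= 1]; for [q > p] it is 0. Hence the rate 1 and a sum of finitely many constants. *)
pose t q := r * M p * (rho + 1) ^+ p / M q.
have t0 q : 0 < t q by rewrite divr_gt0 // !mulr_gt0 // exprn_gt0 // addr_gt0.
have K0 : 0 < \sum_(q < p.+1) t q.
  by rewrite big_ord_recr /= ltr_wpDl // sumr_ge0 // => i _; exact: ltW.
exists (\sum_(q < p.+1) t q), 1; split => // z q Tz.
have z0 := T0 z Tz; have zr : z.1 < rho by move: Tz; rewrite TE => -[].
rewrite /remainder expr1n mulr1.
rewrite (eq_bigr (fun i : 'I_q => if i == p :> nat then (M p * r)%:C * Rlog_proj z ^+ p else 0));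
  last by move=> i _; case: eqP => [->//|_]; rewrite mulr0 mul0r.
rewrite -big_mkcond (big_ord1_eq _ (fun=> (M p * r)%:C * Rlog_proj z ^+ p)) /=.
case: ltnP => pq.
  by rewrite subrr cmod0 !mulr_ge0 ?exprn_ge0 ?ltW.
rewrite subr0 cmodM cmod_real cmodX cmod_Rlog_proj ?(ltW z0) // gtr0_norm ?mulr_gt0 //.
have -> : z.1 ^+ p = z.1 ^+ (p - q) * z.1 ^+ q by rewrite -exprD subnK.
rewrite mulrA ler_wpM2r ?exprn_ge0 ?(ltW z0) //.
have qp : (q < p.+1)%N by [].
rewrite (bigD1 (Ordinal qp)) //= mulrDl.
apply: (@le_trans _ _ (t q * M q)); last first.
  by rewrite lerDl mulr_ge0 ?(ltW (Mgt0 q)) // sumr_ge0 // => i _; exact: ltW.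
rewrite /t divfK ?gt_eqF // [M p * r]mulrC ler_wpM2l ?mulr_ge0 ?(ltW r0) ?(ltW (Mgt0 p)) //.
have r1 : 1 <= rho + 1 by rewrite lerDr ltW.
apply: (@le_trans _ _ ((rho + 1) ^+ (p - q))).
  by rewrite lerXn2r ?nnegrE ?(ltW z0) ?(le_trans ler01 r1) // (le_trans (ltW zr)) // lerDl.
by rewrite ler_weXn2l // leq_subr.
Qed.

(** The quotients are eventually at least 2, so [M] grows at least like [2^n]. *)
Lemma weight_sequence_unbounded (B : R) : exists p, B < M p.
Proof.
have [_ _ _ /cvgryPge /(_ 2)[P _ HP]] := hM.
have [n] := exists_div_exp2_lt B (Mgt0 P); rewrite ltr_pdivrMr ?exprn_gt0 // => Bn.
exists (P + n)%N; apply: (lt_le_trans Bn) => {Bn}.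
elim: n => [|n IH]; first by rewrite addn0 expr0 mulr1.
have := HP (P + n)%N (leq_addr _ _); rewrite /= ler_pdivlMr // addnS => h.
by apply: le_trans h; rewrite exprS mulrCA ler_pM2l.
Qed.

Lemma class_At_not_bijective :
  surjectivity_set class_At M gamma -> ~ injectivity_set class_At M gamma.
Proof.
move=> [_ surj] [_ inj].
have solvable b : (forall p, `|b p| <= 1) -> exists f, admissible M gamma f b.
  move=> b1; have : series_class M (weighted M b).
    exists 1, 1; split => // p; rewrite lec_cmod cmod_real expr1n !mul1r.
    by rewrite normrM gtr0_norm // ler_piMr ?b1 ?(ltW (Mgt0 p)).
  move=> /surj[f [fh [a fa]] fb]; exists f; split => //.
  by rewrite -fb (borel_eq fa).
have [B [r [r0 H]]] := closed_graph M0 Mgt0 gamma0 solvable.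
have [p Bp] := weight_sequence_unbounded (B / r).
pose b i := if i == p then r else 0.
have [|f [fh fb] fB] := H b.
  by move=> i; rewrite /b; case: eqP => _; rewrite ?normr0 ?gtr0_norm // ltW.
have [gh gb] := admissible_monomial p r0.
have zc : cone gamma 0 (1, 0).
  apply/coneP; split => //=; last by rewrite ltr1n.
  by rewrite normr0 !mulr_gt0 // ?pi_gt0 // ?invr_gt0.
(* Injectivity identifies the bounded solution with the monomial; at the point 1 this reads
   [M p * r <= B], against the choice of [p]. *)
have := inj f _ (conj fh (ex_intro _ _ fb)) (conj gh (ex_intro _ _ gb)).
rewrite (borel_eq fb) (borel_eq gb) => /(_ erefl (1, 0) (cone_sector gamma0 zc)) fE.
have := fB _ zc; rewrite fE cmodM cmod_real cmodX cmod_Rlog_proj // expr1n mulr1.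
rewrite gtr0_norm ?mulr_gt0 // -ler_pdivlMr //.
by apply/negP; rewrite -ltNge.
Qed.

(** * Dilation by 2 and the two uniform classes *)

Definition double (z : R * R) : R * R := (2 * z.1, z.2).

Definition dilate f : R * R -> C := fun z => 2^-1 * f (double z).

Lemma Rlog_proj_double z : Rlog_proj (double z) = 2 * Rlog_proj z.
Proof. by rewrite /Rlog_proj /double -[2 in RHS](rmorph_nat (real_complex R)) /=; complex_ring. Qed.

Lemma sector_double z : sector gamma z -> sector gamma (double z).
Proof. by move=> [z0 zg]; split => //; rewrite /Rlog /= mulr_gt0. Qed.

Lemma is_derivative_double f z (c l : C) : is_derivative f (double z) l ->
  is_derivative (fun w => c * f (double w) : C) z (c * 2 * l).
Proof.
move=> /is_derivativeP H; apply/is_derivativeP => e e0.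
have c0 : 0 < 2 * cmod c + 1 by rewrite ltr_wpDl // mulr_ge0 // cmod_ge0.
have [d d0 Hd] := H _ (divr_gt0 e0 c0); exists (d / 2); first by rewrite divr_gt0.
move=> z' h1 h2 zz.
have k1 : `|(double z').1 - (double z).1| < d.
  by rewrite /= -mulrBr normrM ger0_norm //; move: `|_| h1 => t; lra.
have k2 : `|(double z').2 - (double z).2| < d.
  by apply: lt_trans h2 _; move: (d) d0 => t; lra.
have k3 : double z' != double z.
  apply: contra_neq zz; case: z z' {H Hd h1 h2 k1 k2} => x y [x' y'] [xx ->].
  by congr (_, _); apply: mulfI xx; rewrite pnatr_eq0.
have K := Hd _ k1 k2 k3; rewrite !Rlog_proj_double -mulrBr invfM in K.
set q := (Rlog_proj z' - _)^-1 in K *.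
have -> : (c * f (double z') - c * f (double z)) * q - c * 2 * l =
  c * 2 * ((f (double z') - f (double z)) * (2^-1 * q) - l).
  by field.
have c2 : cmod (2 : R[i]) = 2.
  by rewrite -[2](rmorph_nat (real_complex R)) cmod_real ger0_norm.
rewrite cmodM cmodM c2 (le_trans (ler_wpM2l _ K)) ?mulr_ge0 ?cmod_ge0 //.
by rewrite mulrA ler_pdivrMr // mulrC ler_pM2l // mulrC lerDl.
Qed.

Lemma holomorphic_dilate f : holomorphic_on (sector gamma) f ->
  holomorphic_on (sector gamma) (dilate f).
Proof.
move=> fh z /sector_double/fh[l hl]; exists (2^-1 * 2 * l).
exact: is_derivative_double.
Qed.

Lemma cmod_nat n : cmod (n%:R : R[i]) = n%:R.
Proof. by rewrite -(rmorph_nat (real_complex R)) cmod_real ger0_norm. Qed.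

Lemma expansion_dilate (T T' : set (R * R)) f a : (forall z, T z -> T' (double z)) ->
  expansion_on M T' f a -> expansion_on M T (dilate f) (fun i => 2^-1 * 2 ^+ i * a i).
Proof.
move=> TT' [K [A [K0 A0 H]]]; exists (K / 2), (2 * A).
split; [by rewrite divr_gt0|by rewrite mulr_gt0|move=> z p Tz].
have := H _ p (TT' z Tz); rewrite !lec_cmod => h.
have -> : dilate f z - \sum_(i < p) 2^-1 * 2 ^+ i * a i * Rlog_proj z ^+ i =
    2^-1 * (f (double z) - \sum_(i < p) a i * Rlog_proj (double z) ^+ i).
  rewrite mulrBr mulr_sumr; congr (_ - _); apply: eq_bigr => i _.
  by rewrite Rlog_proj_double exprMn -!mulrA; congr (_ * _); rewrite mulrCA.
rewrite cmodM cmodV cmod_nat.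
apply: (le_trans (ler_wpM2l _ h)); first by rewrite invr_ge0.
by rewrite le_eqVlt; apply/orP; left; apply/eqP; rewrite /double /= !exprMn; ring.
Qed.

Definition series_X : nat -> C := fun i => if i == 1%N then 1 else 0.

(** Doubling sends each cone into a larger one of the exhaustion, and the factor [2^-1] restores the
    coefficient of [z]. *)
Lemma asymptotic_expansion_dilate f : asymptotic_expansion M gamma f series_X ->
  asymptotic_expansion M gamma (dilate f) series_X.
Proof.
move=> fX T /(proper_subsector_cone gamma0)[j Tj].
have [j' Hj'] := bounded_sector_cone gamma0 (2 * j.+2%:R) (cone_angle gamma0 j).
have sub z : T z -> cone gamma j' (double z).
  move=> /Tj/coneP[z0 zg zr]; apply: Hj' => //=.
  by rewrite mulr_gt0 //= ltr_pM2l.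
have := expansion_dilate sub (fX _ (proper_cone gamma0 j')).
suff -> : (fun i => 2^-1 * 2 ^+ i * series_X i) = series_X by [].
apply/funext => i; rewrite /series_X; case: eqP => [->|_]; last by rewrite mulr0.
by rewrite expr1 mulr1 mulVf // pnatr_eq0.
Qed.

(** Boundedness on the whole sector is decisive: [f (2^n z) = 2^n * f z] for all [n] then forces
    [f z = 0]. *)
Lemma not_bijective_of_dilation (cls : (nat -> R) -> R -> set (R * R -> C)) :
  (forall f, cls M gamma f -> cls M gamma (dilate f)) ->
  (forall f, cls M gamma f -> exists B, forall z, sector gamma z -> cmod (f z) <= B) ->
  surjectivity_set cls M gamma -> ~ injectivity_set cls M gamma.
Proof.
move=> cls_dilate cls_bounded [_ surj] [_ inj].
have : series_class M series_X.
  exists 1, (M 1%N)^-1; split => // p; rewrite lec_cmod /series_X expr1n mulr1.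
  case: eqP => [->|_]; first by rewrite cmod1 mulVf // gt_eqF.
  by rewrite cmod0 mulr_ge0 ?invr_ge0 // ltW.
have X0 : series_X <> fun=> 0.
  by move=> /(congr1 (@^~ 1%N)) /eqP; rewrite /series_X /= oner_eq0.
move=> /surj[f fcls fX]; have fE := borel_neq0 fX X0.
have ff z : sector gamma z -> f (double z) = 2 * f z.
  have bE : borel M gamma f = borel M gamma (dilate f).
    by rewrite fX (borel_eq (asymptotic_expansion_dilate fE)).
  move=> /(inj f (dilate f) fcls (cls_dilate f fcls) bE) ->.
  by rewrite /dilate mulrA divff ?mul1r // pnatr_eq0.
have iter_ff n z : sector gamma z -> sector gamma (iter n double z) /\
    f (iter n double z) = 2 ^+ n * f z.
  move=> zS; elim: n => [|n [IH1 IH2]]; first by rewrite expr0 mul1r.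
  by rewrite /=; split; [exact: sector_double|rewrite ff // IH2 exprS mulrA].
have [B fB] := cls_bounded f fcls.
have f0 z : sector gamma z -> f z = 0.
  move=> zS; apply/eqP; rewrite -cmod_eq0; apply/negP => /negP c0.
  have cp : 0 < cmod (f z) by rewrite lt_neqAle eq_sym c0 cmod_ge0.
  have [n] := exists_div_exp2_lt B cp; rewrite ltr_pdivrMr ?exprn_gt0 //.
  have [iS iE] := iter_ff n z zS; have := fB _ iS.
  by rewrite iE cmodM cmodX cmod_nat mulrC leNgt => /negP.
(* A function vanishing on the sector also has the zero expansion, so uniqueness would make
   [series_X] zero. *)
apply: X0; apply: (asymptotic_expansion_unique fE) => T pT.
have [j Tj] := proper_subsector_cone gamma0 pT.
exists 1, 1; split => // z p Tz; have zS := cone_sector gamma0 (Tj z Tz).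
rewrite f0 // big1 => [|i _]; last by rewrite mul0r.
rewrite subrr lec_cmod cmod0 !mulr_ge0 ?exprn_ge0 ?(ltW (Mgt0 p)) //.
by case: zS => z0 _; exact: ltW.
Qed.

Lemma class_Atu_dilate f : class_Atu M gamma f -> class_Atu M gamma (dilate f).
Proof.
move=> [fh [a fa]]; split; first exact: holomorphic_dilate.
by exists (fun i => 2^-1 * 2 ^+ i * a i); apply: expansion_dilate fa; exact: sector_double.
Qed.

Lemma class_Atu_bounded f : class_Atu M gamma f ->
  exists B, forall z, sector gamma z -> cmod (f z) <= B.
Proof.
move=> [_ [a [K [A [_ _ H]]]]]; exists K => z zS.
by have := H z 0%N zS; rewrite big_ord0 subr0 lec_cmod !expr0 M0 !mulr1.
Qed.

Lemma class_A_dilate f : class_A M gamma f -> class_A M gamma (dilate f).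
Proof.
move=> [fh [F [[F0 FS] [A [K [A0 H]]]]]]; split; first exact: holomorphic_dilate.
exists (fun n z => 2^-1 * 2 ^+ n * F n (double z)); split.
  split=> [z zS|n z /sector_double zS].
    by rewrite expr0 mulr1 F0 //; exact: sector_double.
  rewrite exprSr mulrA -[_ * 2 * _]/(_ * _ * _).
  exact: is_derivative_double (FS n _ zS).
exists (2 * A), (K / 2); split; first by rewrite mulr_gt0.
move=> n z /sector_double zS; have := H n _ zS; rewrite !lec_cmod => h.
rewrite !cmodM cmodV cmodX cmod_nat.
apply: (le_trans (ler_wpM2l _ h)); first by rewrite mulr_ge0 ?invr_ge0 ?exprn_ge0.
by rewrite le_eqVlt; apply/orP; left; apply/eqP; rewrite exprMn; ring.
Qed.

Lemma class_A_bounded f : class_A M gamma f ->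
  exists B, forall z, sector gamma z -> cmod (f z) <= B.
Proof.
move=> [_ [F [[F0 _] [A [K [_ H]]]]]]; exists K => z zS.
by have := H 0%N z zS; rewrite lec_cmod F0 // expr0 fact0 M0 !mulr1.
Qed.

End BorelMap.

Theorem theorem3p17 (R : realType) (M : nat -> R) (hM : weight_sequence M) :
  [/\ surjectivity_set class_A M `&` injectivity_set class_A M = set0,
      surjectivity_set class_Atu M `&` injectivity_set class_Atu M = set0
    & surjectivity_set class_At M `&` injectivity_set class_At M = set0].
Proof.
split; apply/seteqP; split => // gamma [gs gi]; have g0 := gs.1.
- apply: (not_bijective_of_dilation hM g0 _ _ gs gi).
    exact: class_A_dilate.
  exact: class_A_bounded.
- apply: (not_bijective_of_dilation hM g0 _ _ gs gi).
    exact: class_Atu_dilate.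
  exact: class_Atu_bounded.
- exact: (class_At_not_bijective hM g0 gs gi).
Qed.
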